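(* For most closed convex curves $C\in\mathcal{C}$ and for every point $v\in\mathbb{R}^2\setminus C$, most points of $\mathbb{R}^2$ see continuum many images of $v$. That is, there is a comeagre set of curves $C\in\mathcal{C}$ such that $C$ has a unique tangent line at each of its points and, for every $v\in\mathbb{R}^2\setminus C$, the set of those $u\in\mathbb{R}^2$ for which $\{z\in C: u \text{ sees an image of } v \text{ via } z\}$ has the cardinality of the continuum is comeagre in $\mathbb{R}^2$.
   Context: $\mathcal{C}$ is the set of all closed convex curves in the plane $\mathbb{R}^2$ (boundaries of compact convex sets with non-empty interior), equipped with the Hausdorff metric. ''Most'' is meant in the Baire category sense: a property holds for most elements of a space if it holds for all elements of a comeagre (residual) subset. For most $C\in\mathcal{C}$ the tangent (supporting) line $T(z)$ to $C$ at $z$ is unique at every $z\in C$; then the normal line $N(z)$ to $C$ at $z$ (the line through $z$ orthogonal to $T(z)$) is also unique. A point $u\in\mathbb{R}^2$ sees an image of a point $v\in\mathbb{R}^2$ via $z\in C$ if $u$, $v$ and $C$ lie on the same side of $T(z)$ and the line $N(z)$ halves the angle $\angle uzv$. *)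

(* Defs.v *)
From HB Require Import structures.
From mathcomp Require Import all_boot all_order all_algebra.
From mathcomp Require Import all_classical all_reals all_analysis.
From mathcomp Require Import ring lra.
Set Implicit Arguments.
Unset Strict Implicit.
Unset Printing Implicit Defensive.
Import Order.TTheory GRing.Theory Num.Theory.
Import numFieldNormedType.Exports.
Local Open Scope classical_set_scope.
Local Open Scope ring_scope.

Section BaireCategory.
Context {T : topologicalType}.
Implicit Types A : set T.

Definition nowhere_dense A := (closure A)° = set0.

Definition meagre A := exists F : nat -> set T,
  (forall n, nowhere_dense (F n)) /\ A `<=` \bigcup_n F n.

Definition comeagre A := meagre (~` A).

Definition boundary A := closure A `\` A°.

End BaireCategory.

(* The norm carried by ['rV[R]_2] in the library is the sup norm, hence the
   separate Euclidean structure. The topology is the usual one. *)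
Notation plane R := 'rV[R]_2.

Section Euclidean.
Context {R : realType}.
Implicit Types (p q z u v w n : plane R) (c : R) (A L : set (plane R)).

Definition dot p q : R := \sum_(i < 2) p ord0 i * q ord0 i.
Definition enorm p : R := Num.sqrt (dot p p).
Definition edist p q : R := enorm (p - q).

(* Convex angle between the rays [z p) and [z q), in [0, pi];
   meaningful only for p, q different from z. *)
Definition angle p z q : R :=
  acos (dot (p - z) (q - z) / (enorm (p - z) * enorm (q - z))).

Definition line n c : set (plane R) := [set p | dot n p = c].
Definition half_plane n c : set (plane R) := [set p | dot n p <= c].

(* L is a line and A lies in one of the two closed half-planes bounded by L
   (the other half-plane of [line n c] is obtained from -n and -c). *)
Definition same_side L A :=
  exists n c, [/\ n != 0, L = line n c & A `<=` half_plane n c].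

Definition supporting_line A z L := L z /\ same_side L A.

Definition normal_line L z : set (plane R) :=
  [set p | forall q, L q -> dot (p - z) (q - z) = 0].

(* The line L through z contains a ray from z that cuts the angle u z v into
   two angles of half its size. *)
Definition halves_angle L u z v :=
  [/\ u != z, v != z &
    exists w, [/\ L w, w != z,
      angle u z w = angle u z v / 2 & angle w z v = angle u z v / 2]].

Definition sees_image A u v z := exists T, [/\ supporting_line A z T,
  same_side T (A `|` [set u; v]) & halves_angle (normal_line T z) u z v].

Definition hausdorff_bounds A B : set R := [set e | [/\ 0 <= e,
  forall a, A a -> exists2 b, B b & edist a b <= e &
  forall b, B b -> exists2 a, A a & edist a b <= e]].

Definition hausdorff_dist A B : R := inf (hausdorff_bounds A B).

Definition is_convex_curve A := exists K : set (plane R),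
  [/\ compact K, convex_set K, K° !=set0 & A = boundary K].

End Euclidean.

Record convex_curve (R : realType) := ConvexCurve {
  curve_set :> plane R -> Prop;
  curve_setP : is_convex_curve curve_set }.

Section HausdorffMetric.
Context {R : realType}.
Implicit Types (p q : plane R) (A B : set (plane R)) (C D : convex_curve R).

Lemma dot2E p q :
  dot p q = p ord0 ord0 * q ord0 ord0 + p ord0 ord_max * q ord0 ord_max.
Proof.
rewrite /dot big_ord_recl big_ord1.
by have -> : lift ord0 ord0 = ord_max :> 'I_2 by exact/val_inj.
Qed.

Lemma dot_ge0 p : 0 <= dot p p.
Proof. by rewrite dot2E addr_ge0// -expr2 sqr_ge0. Qed.

Lemma edist_ge0 p q : 0 <= edist p q.
Proof. exact: sqrtr_ge0. Qed.

Lemma edistxx p : edist p p = 0.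
Proof. by rewrite /edist /enorm subrr dot2E !mxE !mul0r addr0 sqrtr0. Qed.

Lemma edistC p q : edist p q = edist q p.
Proof. by rewrite /edist /enorm !dot2E !mxE; congr (Num.sqrt _); ring. Qed.

Lemma enormD p q : enorm (p + q) <= enorm p + enorm q.
Proof.
rewrite -(@ler_pXn2r _ 2)// ?nnegrE ?addr_ge0 ?sqrtr_ge0//.
rewrite sqrrD !sqr_sqrtr ?dot_ge0//.
suff : dot p q <= enorm p * enorm q by rewrite !dot2E !mxE => H; lra.
apply: (le_trans (ler_norm _)).
rewrite -(@ler_pXn2r _ 2)// ?nnegrE ?mulr_ge0 ?sqrtr_ge0//.
rewrite exprMn !sqr_sqrtr ?dot_ge0// real_normK ?num_real// !dot2E -subr_ge0.
move: (p ord0 ord0) (p ord0 ord_max) (q ord0 ord0) (q ord0 ord_max).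
move=> a b c d.
have -> : (a * a + b * b) * (c * c + d * d) - (a * c + b * d) ^+ 2
  = (a * d - b * c) ^+ 2 by ring.
exact: sqr_ge0.
Qed.

Lemma edist_triangle q p r : edist p r <= edist p q + edist q r.
Proof. by rewrite /edist -[p - r](subrKA q); exact: enormD. Qed.

Lemma coord_le_enorm p i : `|p ord0 i| <= enorm p.
Proof.
rewrite -[leLHS]ger0_norm// -sqrtr_sqr ler_wsqrtr// real_normK ?num_real//.
rewrite /dot (bigD1 i)//= -expr2 lerDl sumr_ge0// => j _.
by rewrite -expr2 sqr_ge0.
Qed.

Lemma coord_le_norm p i : `|p ord0 i| <= `|p|.
Proof.
rewrite [leRHS]mx_normrE.
exact: (le_bigmax _ (fun ij : 'I_1 * 'I_2 => `|p ij.1 ij.2|) (ord0, i)).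
Qed.

Lemma norm_le_enorm p : `|p| <= enorm p.
Proof.
rewrite [leLHS]mx_normrE; apply/bigmax_leP; split; first exact: sqrtr_ge0.
by case=> i j _; rewrite [i]ord1; exact: coord_le_enorm.
Qed.

Lemma enorm_le_norm p : enorm p <= 2 * `|p|.
Proof.
rewrite -(@ler_pXn2r _ 2)// ?nnegrE ?mulr_ge0 ?sqrtr_ge0//.
rewrite sqr_sqrtr ?dot_ge0// dot2E.
have H i : p ord0 i * p ord0 i <= `|p| ^+ 2.
  rewrite -expr2 -real_normK ?num_real// ler_pXn2r// ?nnegrE//.
  exact: coord_le_norm.
by have := H ord0; have := H ord_max; have := sqr_ge0 `|p|; nra.
Qed.

Lemma convex_curve_closed C : closed C.
Proof.
have [K [_ _ _ ->]] := curve_setP C.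
rewrite /boundary setDE; apply: closedI; first exact: closed_closure.
by apply: open_closedC; exact: open_interior.
Qed.

Lemma compactK_closed A : compact A -> closed A.
Proof. by apply: compact_closed; exact: norm_hausdorff. Qed.

Lemma convex_curve_bounded C : exists2 M, 0 <= M & forall p, C p -> enorm p <= M.
Proof.
have [K [cK _ _ CK]] := curve_setP C.
have [M [_ /(_ (`|M| + 1)) HM]] := compact_bounded cK.
exists (2 * (`|M| + 1)) => [|p]; first by rewrite mulr_ge0// addr_ge0.
rewrite CK => -[/(compactK_closed cK) Kp _].
apply: (le_trans (enorm_le_norm _)); rewrite ler_pM2l//.
by apply: HM => //; rewrite (le_lt_trans (ler_norm _))// ltrDl.
Qed.

Lemma convex_curve_neq0 C : exists p, C p.
Proof.
have [K [cK _ [p Kp] ->]] := curve_setP C.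
have clK := compactK_closed cK.
pose e : plane R := const_mx 1; pose f (t : R) := p + t *: e.
have fc : continuous f.
  by move=> t; apply: cvgD; [exact: cvg_cst|apply: cvgZr_tmp; exact: cvg_id].
have T0 : (f @^-1` K) 0 by rewrite /= /f scale0r addr0; exact: interior_subset.
have [M [_ /(_ (`|M| + 1)) HM]] := compact_bounded cK.
have Tb : has_ubound (f @^-1` K).
  exists (`|M| + 1 + `|p|) => t /= Kt.
  have {Kt} : `|f t| <= `|M| + 1.
    by apply: HM => //; rewrite (le_lt_trans (ler_norm _))// ltrDl.
  have := coord_le_norm (f t) ord0; have := coord_le_norm p ord0.
  rewrite !mxE mulr1 => h1 h2 h3.
  have := ler_norm (p ord0 ord0 + t); have := ler_norm (- p ord0 ord0).
  by rewrite normrN; lra.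
have cT : closed (f @^-1` K) by exact: closed_comp.
have Ts : K (f (sup (f @^-1` K))).
  by apply: cT; apply: closure_sup => //; exists 0.
exists (f (sup (f @^-1` K))); split; first exact: subset_closure.
rewrite /interior => /fc /nbhs_ballP [_/posnumP[d]] /(_ (sup (f @^-1` K) + d%:num / 2)).
rewrite /ball/= opprD addrA subrr sub0r normrN gtr0_norm// ltr_pdivrMr//.
rewrite ltr_pMr// ltr1n => /(_ isT) /(ub_le_sup Tb).
by rewrite leNgt ltrDl divr_gt0.
Qed.

Lemma hausdorff_bounds_neq0 C D : hausdorff_bounds C D !=set0.
Proof.
have [M M0 HM] := convex_curve_bounded C.
have [N N0 HN] := convex_curve_bounded D.
have [c Cc] := convex_curve_neq0 C; have [d Dd] := convex_curve_neq0 D.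
have enormN p : enorm (- p) = enorm p.
  by rewrite /enorm !dot2E !mxE; congr (Num.sqrt _); ring.
have H p q : C p -> D q -> edist p q <= M + N.
  move=> Cp Dq; rewrite (le_trans (enormD _ _))// enormN.
  by rewrite lerD// ?HM ?HN.
exists (M + N); split; first exact: addr_ge0.
- by move=> a Ca; exists d => //; exact: H.
- by move=> b Db; exists c => //; exact: H.
Qed.

Lemma hausdorff_bounds_lb A B : lbound (hausdorff_bounds A B) 0.
Proof. by move=> e []. Qed.

Lemma hausdorff_boundsC A B : hausdorff_bounds A B = hausdorff_bounds B A.
Proof.
suff H (E F : set (plane R)) : hausdorff_bounds E F `<=` hausdorff_bounds F E.
  exact/seteqP.
move=> e [e0 EF FE]; split=> // a aE.
- by have [b ? ?] := FE a aE; exists b; rewrite 1?edistC.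
- by have [b ? ?] := EF a aE; exists b; rewrite 1?edistC.
Qed.

Lemma hausdorff_distxx C : hausdorff_dist C C = 0.
Proof.
apply/eqP; rewrite eq_le lb_le_inf ?andbT; last first.
- exact: hausdorff_bounds_lb.
- exact: hausdorff_bounds_neq0.
apply: ge_inf; first by exists 0; exact: hausdorff_bounds_lb.
by split=> // a Ca; exists a; rewrite // edistxx.
Qed.

Lemma hausdorff_distC C D : hausdorff_dist C D = hausdorff_dist D C.
Proof. by rewrite /hausdorff_dist hausdorff_boundsC. Qed.

Lemma hausdorff_dist_adherent C D (r : R) : hausdorff_dist C D < r ->
  exists2 e, hausdorff_bounds C D e & e < r.
Proof.
rewrite -subr_gt0 => /inf_adherent-/(_ (hausdorff_bounds C D)) [].
  split; [exact: hausdorff_bounds_neq0|].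
  by exists 0; exact: hausdorff_bounds_lb.
by move=> e ?; rewrite -/(hausdorff_dist C D) addrC subrK; exists e.
Qed.

Lemma hausdorff_dist_triangle D C (E : convex_curve R) :
  hausdorff_dist C E <= hausdorff_dist C D + hausdorff_dist D E.
Proof.
apply/ler_addgt0Pl => e e0.
have [r [r0 CD DC] re] : exists2 r, hausdorff_bounds C D r &
    r < hausdorff_dist C D + e / 2.
  by apply: hausdorff_dist_adherent; rewrite ltrDl divr_gt0.
have [s [s0 DE ED] se] : exists2 s, hausdorff_bounds D E s &
    s < hausdorff_dist D E + e / 2.
  by apply: hausdorff_dist_adherent; rewrite ltrDl divr_gt0.
apply: (@le_trans _ _ (r + s)); last by lra.
apply: ge_inf; first by exists 0; exact: hausdorff_bounds_lb.
split=> [|a Ca|b Eb]; first exact: addr_ge0.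
- have [d Dd ad] := CD a Ca; have [b Eb db] := DE d Dd.
  by exists b => //; rewrite (le_trans (edist_triangle d _ _))// lerD.
- have [d Dd db] := ED b Eb; have [a Ca ad] := DC d Dd.
  by exists a => //; rewrite (le_trans (edist_triangle d _ _))// lerD.
Qed.

Lemma hausdorff_dist_positivity C D : hausdorff_dist C D = 0 -> C = D.
Proof.
have sub (C1 C2 : convex_curve R) : hausdorff_dist C1 C2 = 0 ->
    (C1 : set (plane R)) `<=` C2.
  move=> C12 p C1p; apply: convex_curve_closed => U.
  move=> /nbhs_ballP[_/posnumP[e]] eU.
  have [|r [_ /(_ p C1p) [q C2q pq] _] re] := @hausdorff_dist_adherent C1 C2 e%:num.
    by rewrite C12.
  exists q; split => //; apply: eU.
  rewrite -ball_normE /ball_/=.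
  by rewrite (le_lt_trans (norm_le_enorm _))// (le_lt_trans pq).
move=> CD; have : (C : set (plane R)) = D.
  by apply/seteqP; split; apply: sub; rewrite // hausdorff_distC.
case: C D {CD} => [C hC] [D hD] /= CD; subst D.
by rewrite (Prop_irrelevance hC hD).
Qed.

End HausdorffMetric.

HB.instance Definition _ (R : realType) := gen_eqMixin (convex_curve R).
HB.instance Definition _ (R : realType) := gen_choiceMixin (convex_curve R).
HB.instance Definition _ (R : realType) := @isMetric.Build R (convex_curve R)
  (fun C D => hausdorff_dist C D) hausdorff_distxx hausdorff_dist_positivity
  hausdorff_distC hausdorff_dist_triangle.

(* Main.v *)
Require Import Defs.
From mathcomp Require Import all_boot all_order all_algebra.
From mathcomp Require Import all_classical all_reals all_analysis.
From mathcomp Require Import ring lra.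
Import Defs.
Set Implicit Arguments.
Unset Strict Implicit.
Unset Printing Implicit Defensive.
Import Order.TTheory GRing.Theory Num.Theory.
Import numFieldNormedType.Exports.
Local Open Scope classical_set_scope.
Local Open Scope ring_scope.

(** Fix a strictly convex smooth curve [C], a source [v], and parametrize [C] by
    the slope [s] of its normal ([touch]). An observer [u] sees an image of [v]
    at the point of slope [s] when the mirror functional [mirror C E u v s]
    vanishes while [u] and [v] lie strictly below the tangent line there
    ([mirror_sees]). This functional is continuous in [s] and affine in [u].
    Its variation with [s] has two competing causes. The displacement of the
    contact point makes it decrease; the rotation of the tangent line makes it
    increase when it is near zero, since [C] is a concave mirror seen from
    inside. Where the curve is almost flat the displacement wins
    ([mirror_decrease]), where it is almost cornered the rotation wins
    ([mirror_increase]).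

    For most curves both situations occur, to any degree, in every interval of
    normals ([typical], [typical_comeagre]): adjoining two points to a convex
    body produces an edge with a prescribed normal, adjoining one point produces
    a corner, and both leave a trace on all curves that are close enough. The
    edges exclude, in the limit, points with several normals, and corners placed
    anywhere on the curve exclude segments, so that typical curves are smooth
    and strictly convex ([typical_normal_unique], [typical_face_unique]).

    Suppose that the functional of [u] changes sign on an interval of slopes. By
    the preceding remarks, moving [u] slightly creates near a zero a sign change
    of the opposite kind ([typical_falling], [typical_rising]), and thus two
    sign changes of the original kind on disjoint subintervals with rational
    ends ([flips_split]). There are countably many such intervals and sign
    changes are stable, so for most [u] every sign change splits, and a Cantor
    scheme gives continuum many zeros ([cantor_zeros]). A first sign change is
    available for a dense set of [u]: every [u] has a point of reflection,
    namely the point of [C] at which the sum of the distances to [u] and [v] is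
    largest ([ellipse_contact]). There the ellipse with foci [u] and [v]
    encloses [C] and has the same tangent line, so that [u] and [v] are strictly
    on the side of the curve, wherever they are. *)

(** * Euclidean algebra of the plane *)

Section PlaneAlgebra.
Context {R : realType}.
Implicit Types (p q r w : plane R) (k : R).

(** The quarter turn, which sends outward normals of a convex curve to tangent
    vectors in the direction of increasing normals. *)
Definition rot p : plane R :=
  \row_i (if i == ord0 then - p ord0 ord_max else p ord0 ord0).

Lemma plane_eqP p q :
  p ord0 ord0 = q ord0 ord0 -> p ord0 ord_max = q ord0 ord_max -> p = q.
Proof.
move=> h0 h1; apply/rowP => -[[|[|//]] hi].
- by rewrite (_ : Ordinal hi = ord0)//; exact: val_inj.
- by rewrite (_ : Ordinal hi = ord_max)//; exact: val_inj.
Qed.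

Lemma dotC p q : dot p q = dot q p.
Proof. by rewrite !dot2E; ring. Qed.

Lemma dotDl p q r : dot (p + q) r = dot p r + dot q r.
Proof. by rewrite !dot2E !mxE; ring. Qed.

Lemma dotNl p q : dot (- p) q = - dot p q.
Proof. by rewrite !dot2E !mxE; ring. Qed.

Lemma dotZl k p q : dot (k *: p) q = k * dot p q.
Proof. by rewrite !dot2E !mxE; ring. Qed.

Lemma dotBl p q r : dot (p - q) r = dot p r - dot q r.
Proof. by rewrite dotDl dotNl. Qed.

Lemma dotDr p q r : dot r (p + q) = dot r p + dot r q.
Proof. by rewrite !(dotC r) dotDl. Qed.

Lemma dotNr p q : dot q (- p) = - dot q p.
Proof. by rewrite !(dotC q) dotNl. Qed.

Lemma dotZr k p q : dot q (k *: p) = k * dot q p.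
Proof. by rewrite !(dotC q) dotZl. Qed.

Lemma dotBr p q r : dot r (p - q) = dot r p - dot r q.
Proof. by rewrite dotDr dotNr. Qed.

Lemma dot0l p : dot 0 p = 0.
Proof. by rewrite !dot2E !mxE; ring. Qed.

Lemma dot0r p : dot p 0 = 0.
Proof. by rewrite dotC dot0l. Qed.

Definition dotE := (dotDl, dotDr, dotNl, dotNr, dotZl, dotZr).

Lemma dot_eq0 p : dot p p = 0 -> p = 0.
Proof.
rewrite dot2E => h; apply: plane_eqP; rewrite mxE; nra.
Qed.

Lemma dot_gt0 p : p != 0 -> 0 < dot p p.
Proof.
move=> p0; rewrite lt_neqAle dot_ge0 andbT eq_sym.
by apply: contra_neq p0; exact: dot_eq0.
Qed.

Lemma dot_rotr p : dot p (rot p) = 0.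
Proof. by rewrite dot2E !mxE /=; ring. Qed.

Lemma dot_rotl p : dot (rot p) p = 0.
Proof. by rewrite dotC dot_rotr. Qed.

Lemma dot_rot p q : dot (rot p) (rot q) = dot p q.
Proof. by rewrite !dot2E !mxE /=; ring. Qed.

Lemma rotD p q : rot (p + q) = rot p + rot q.
Proof. by apply: plane_eqP; rewrite !mxE /= ?mxE //; ring. Qed.

Lemma rotZ k p : rot (k *: p) = k *: rot p.
Proof. by apply: plane_eqP; rewrite !mxE /= ?mxE //; ring. Qed.

Lemma rot_rot p : rot (rot p) = - p.
Proof. by apply: plane_eqP; rewrite !mxE /= ?mxE. Qed.

Lemma rot_neq0 p : p != 0 -> rot p != 0.
Proof.
move=> p0; have := dot_gt0 p0; rewrite -dot_rot.
by apply: contraTneq => ->; rewrite dot0l ltxx.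
Qed.

Lemma frameE w p : dot w w *: p = dot p w *: w + dot p (rot w) *: rot w.
Proof. by apply: plane_eqP; rewrite !mxE !dot2E !mxE /=; ring. Qed.

Lemma enorm_ge0 p : 0 <= enorm p.
Proof. exact: sqrtr_ge0. Qed.

Lemma sqr_enorm p : enorm p ^+ 2 = dot p p.
Proof. by rewrite sqr_sqrtr// dot_ge0. Qed.

Lemma enorm0 : enorm (0 : plane R) = 0.
Proof. by rewrite /enorm dot0l sqrtr0. Qed.

Lemma enorm_gt0 p : p != 0 -> 0 < enorm p.
Proof. by move=> p0; rewrite sqrtr_gt0 dot_gt0. Qed.

Lemma enormN p : enorm (- p) = enorm p.
Proof. by rewrite /enorm dotNl dotNr opprK. Qed.

Lemma enormZ k p : enorm (k *: p) = `|k| * enorm p.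
Proof.
by rewrite /enorm dotZl dotZr mulrA sqrtrM -?expr2 ?sqr_ge0// sqrtr_sqr.
Qed.

Lemma enormB p q : enorm (p - q) = enorm (q - p).
Proof. by rewrite -enormN opprB. Qed.

Lemma enorm_rot p : enorm (rot p) = enorm p.
Proof. by rewrite /enorm dot_rot. Qed.

(** The Cauchy-Schwarz defect is the square of the cross product. *)
Lemma lagrange_identity p q :
  dot p q ^+ 2 + dot p (rot q) ^+ 2 = dot p p * dot q q.
Proof. by rewrite !dot2E !mxE /=; ring. Qed.

Lemma normr_dot_le p q : `|dot p q| <= enorm p * enorm q.
Proof.
rewrite -(@ler_pXn2r _ 2)// ?nnegrE ?mulr_ge0 ?enorm_ge0//.
rewrite exprMn !sqr_enorm real_normK ?num_real// -lagrange_identity.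
by rewrite lerDl sqr_ge0.
Qed.

Lemma dot_le_enorm p q : dot p q <= enorm p * enorm q.
Proof. exact: le_trans (ler_norm _) (normr_dot_le p q). Qed.

Lemma dot_ge_enorm p q : - (enorm p * enorm q) <= dot p q.
Proof. by have := normr_dot_le p q; rewrite ler_norml => /andP[]. Qed.

(** The library norm of the plane is the maximum norm; this and the next lemmas
    let the Euclidean norm be used for all topological purposes. *)
Lemma nbhs_enormP p (U : set (plane R)) :
  nbhs p U <-> exists2 e, 0 < e & forall q, enorm (q - p) < e -> U q.
Proof.
split=> [/nbhs_ballP[e /= e0 eU]|[e e0 eU]].
  exists e => // q qp; apply: eU; rewrite -ball_normE /ball_/= distrC.
  exact: le_lt_trans (norm_le_enorm _) qp.
apply/nbhs_ballP; exists (e / 2); first by rewrite /= divr_gt0.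
move=> q; rewrite -ball_normE /ball_/= distrC => qp; apply: eU.
by have := enorm_le_norm (q - p); lra.
Qed.

Lemma nbhs_enorm p e : 0 < e -> nbhs p [set q | enorm (q - p) < e].
Proof. by move=> e0; apply/nbhs_enormP; exists e. Qed.

Lemma enorm_lipschitz_continuous (f : plane R -> R) k :
  (forall p q, `|f p - f q| <= k * enorm (p - q)) -> continuous f.
Proof.
move=> fk p; apply/(@cvgrPdist_lt _ _ _ (nbhs p)) => e e0; apply/nbhs_enormP.
have k1 : 0 < `|k| + 1 by rewrite ltr_wpDl.
exists (e / (`|k| + 1)); first by rewrite divr_gt0.
move=> q; rewrite ltr_pdivlMr// enormB => qp.
apply: le_lt_trans (fk _ _) _; apply: le_lt_trans qp.
rewrite mulrC ler_wpM2l ?enorm_ge0//.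
by rewrite (le_trans (ler_norm _))// lerDl.
Qed.

Lemma dot_continuous w : continuous (dot ^~ w : plane R -> R).
Proof.
apply: (@enorm_lipschitz_continuous _ (enorm w)) => p q.
by rewrite -dotBl mulrC normr_dot_le.
Qed.

Lemma normr_edist_le r p q : `|edist p r - edist q r| <= enorm (p - q).
Proof.
have := edist_triangle q p r; have := edist_triangle p q r.
by rewrite /edist (enormB q p) ler_norml => h1 h2; lra.
Qed.

Lemma edist_continuous r : continuous (edist ^~ r : plane R -> R).
Proof.
apply: (@enorm_lipschitz_continuous _ 1) => p q.
by rewrite mul1r normr_edist_le.
Qed.

Lemma compact_attains_max (A : set (plane R)) (f : plane R -> R) :
  compact A -> A !=set0 -> continuous f ->
  exists2 p, A p & forall q, A q -> f q <= f p.
Proof.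
move=> cA A0 cf.
have [|p pA pm] := EVT_max_rV A0 cA (f := f).
  exact: continuous_subspaceT.
by exists p => [|q Aq]; [exact: set_mem|apply: pm; exact: mem_set].
Qed.

Lemma compact_enorm_bounded (A : set (plane R)) :
  compact A -> exists2 M, 0 < M & forall p, A p -> enorm p <= M.
Proof.
move=> cA; have [M [_ /(_ (`|M| + 1)) HM]] := compact_bounded cA.
exists (2 * (`|M| + 1)) => [|p Ap]; first by rewrite mulr_gt0// ltr_wpDl.
apply: (le_trans (enorm_le_norm _)); rewrite ler_pM2l//.
by apply: HM => //; rewrite (le_lt_trans (ler_norm _))// ltrDl.
Qed.

End PlaneAlgebra.

Ltac plane_ring := apply: plane_eqP; rewrite ?mxE /= ?mxE; ring.

(** * Faces of convex bodies *)

Section Faces.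
Context {R : realType}.
Implicit Types (p q r w x y : plane R) (A K : set (plane R)) (k l : R).

Lemma convex_combination K x y l : convex_set K -> K x -> K y ->
  0 <= l -> l <= 1 -> K (l *: x + (1 - l) *: y).
Proof.
move=> cK Kx Ky l0 l1.
by have /set_mem := cK x y (Itv01 l0 l1) (mem_set Kx) (mem_set Ky).
Qed.

Lemma convex_setI01 K :
  (forall x y l, K x -> K y -> 0 <= l -> l <= 1 -> K (l *: x + (1 - l) *: y)) ->
  convex_set K.
Proof.
move=> h x y l /set_mem Kx /set_mem Ky; apply/mem_set.
exact: (h x y l%:num).
Qed.

(** For [w] nonzero and [A] a convex curve or body, these are the points at
    which [w] is an outward normal. *)
Definition face A w : set (plane R) :=
  [set p | A p /\ forall x, A x -> dot x w <= dot p w].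

Lemma face_nonempty A w : compact A -> A !=set0 -> face A w !=set0.
Proof.
move=> cA A0; have [p Ap pm] := compact_attains_max cA A0 (@dot_continuous R w).
by exists p.
Qed.

Lemma faceZ A w k p : 0 < k -> face A (k *: w) p <-> face A w p.
Proof.
move=> k0; split=> -[Ap h]; split=> // x /h; rewrite !dotZr.
- by rewrite ler_pM2l.
- by rewrite ler_pM2l.
Qed.

Lemma face_dot_eq A w p q : face A w p -> face A w q -> dot p w = dot q w.
Proof. by move=> [Ap hp] [Aq hq]; apply/le_anti; rewrite hp// hq. Qed.

Lemma interior_step A p w : A° p -> exists2 e, 0 < e & A (p + e *: w).
Proof.
move=> /nbhs_enormP[e e0 he].
have w1 : 0 < enorm w + 1 by rewrite ltr_wpDl// enorm_ge0.
exists (e / (enorm w + 1)); first by rewrite divr_gt0.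
apply: he; rewrite addrAC subrr add0r enormZ gtr0_norm ?divr_gt0//.
by rewrite mulrAC ltr_pdivrMr// ltr_pM2l// ltrDl.
Qed.

Lemma face_not_interior A w p : w != 0 -> face A w p -> ~ A° p.
Proof.
move=> w0 [Ap pm] /(@interior_step _ _ w)[e e0 /pm].
by rewrite dotDl dotZl gerDl pmulr_rle0// leNgt dot_gt0.
Qed.

Lemma nearest_point K y : compact K -> K !=set0 ->
  exists2 a, K a & forall x, K x -> edist a y <= edist x y.
Proof.
move=> cK K0; have [|a Ka am] := compact_attains_max cK K0
  (f := fun x => - edist x y).
  by move=> p; apply: (@cvgN _ _ _ (nbhs (p : plane R))); exact: edist_continuous.
by exists a => // x /am; rewrite lerN2.
Qed.

(** The direction from the nearest point towards [y] is an outward normal: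
    otherwise a small step from the nearest point would come closer. *)
Lemma nearest_point_face K y a : convex_set K -> K a ->
  (forall x, K x -> edist a y <= edist x y) -> face K (y - a) a.
Proof.
move=> cK Ka am; split=> // x Kx; rewrite -subr_le0 -dotBl leNgt; apply/negP.
set g := dot _ _ => g0.
pose d := dot (x - a) (x - a); have d0 : 0 <= d by exact: dot_ge0.
(* A step small enough for the gain [2 * l * g] to beat the loss [l ^ 2 * d]. *)
pose l := g / (g + d + g).
have gdg : 0 < g + d + g by rewrite addr_gt0// ltr_pwDl.
have l0 : 0 < l by rewrite divr_gt0.
have l1 : l <= 1 by rewrite ler_pdivrMr// mul1r -addrA lerDl addr_ge0// ltW.
have /am := convex_combination cK Kx Ka (ltW l0) l1.
rewrite leNgt => /negP; apply; rewrite /edist /enorm ltr_sqrt; last first.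
  rewrite lt_neqAle dot_ge0 andbT eq_sym; apply/negP => /eqP/dot_eq0.
  by move=> ay; move: g0; rewrite /g -(opprB a y) ay oppr0 dot0r ltxx.
have -> : l *: x + (1 - l) *: a - y = (a - y) + l *: (x - a).
  by plane_ring.
have ldg : l * d < g.
  by rewrite /l mulrAC ltr_pdivrMr// ltr_pM2l//; lra.
have xg : dot (x - a) (a - y) = - g by rewrite /g -(opprB a y) dotNr opprK.
have dE : dot (x - a) (x - a) = d by [].
move: dE xg; move: (a - y) (x - a) => b c dE xg.
rewrite dotDl !dotDr !dotZl !dotZr (dotC b c) xg.
have h : l * (l * d) < l * g by rewrite ltr_pM2l.
have lg : 0 < l * g by rewrite mulr_gt0.
rewrite dE; lra.
Qed.

Lemma separation K y : compact K -> convex_set K -> K !=set0 -> ~ K y ->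
  exists a, [/\ K a, y - a != 0 & face K (y - a) a].
Proof.
move=> cK vK K0 Ky; have [a Ka am] := nearest_point y cK K0.
exists a; split=> //; last exact: nearest_point_face.
by rewrite subr_eq0; apply: contra_notN Ky => /eqP ->.
Qed.

(** Supporting hyperplane theorem: the unit normals that separate nearby
    outside points from [K] accumulate at a normal of [K] at [a]. *)
Lemma supporting_normal K a : compact K -> convex_set K -> K a -> ~ K° a ->
  exists2 w, w != 0 & face K w a.
Proof.
move=> cK vK Ka Kia.
have K0 : K !=set0 by exists a.
pose S := [set w : plane R | enorm w = 1].
have cS : compact S.
  apply: bounded_closed_compact.
    exists 1; split; first exact: num_real.
    by move=> M M1 w Sw /=; rewrite (le_trans (norm_le_enorm _))// Sw ltW.
  have -> : S = (edist ^~ (0 : plane R)) @^-1` [set 1].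
    by apply/seteqP; split=> w; rewrite /S /= /edist subr0.
  by apply: closed_comp => [w _|]; [exact: edist_continuous|exact: closed_eq].
have norm_out y : ~ K y -> exists2 w, S w & forall x, K x -> dot x w <= dot y w.
  move=> /(separation cK vK K0)[b [Kb yb [_ hb]]].
  have n0 := enorm_gt0 yb.
  exists ((enorm (y - b))^-1 *: (y - b)).
    by rewrite /S /= enormZ gtr0_norm ?invr_gt0// mulVf// gt_eqF.
  move=> x /hb xb; rewrite !dotZr ler_pM2l ?invr_gt0// (le_trans xb)//.
  by rewrite -subr_ge0 -dotBl dot_ge0.
(* Some unit vector separating [y] from [K]; outside points converging to [a]
   then have normals that accumulate in the compact unit circle. *)
pose nrm y := xget (0 : plane R)
  [set w | S w /\ forall x, K x -> dot x w <= dot y w].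
have nrmP y : ~ K y ->
    S (nrm y) /\ forall x, K x -> dot x (nrm y) <= dot y (nrm y).
  move=> /norm_out[w Sw hw].
  by rewrite /nrm; case: xgetP => [_ -> //|/(_ w)[]].
have FF : ProperFilter (within (~` K) (nbhs a)).
  apply: within_nbhs_proper => B /nbhs_enormP[e e0 eB].
  apply: contrapT => h; apply: Kia; apply/nbhs_enormP; exists e => // q qa.
  by apply: contrapT => Kq; apply: h; exists q; split=> //; exact: eB.
have [|w [Sw cw]] := cS (nrm @ within (~` K) (nbhs a)) _.
  apply: filterS (withinT _ _) => y Ky; exact: (nrmP y Ky).1.
exists w.
  by apply: contra_eq_neq Sw => ->; rewrite enorm0 eq_sym oner_eq0.
split=> // x Kx; rewrite -subr_le0 -dotBl leNgt; apply/negP.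
set g := dot _ _ => g0.
pose M := enorm (x - a) + 1.
have M0 : 0 < M by rewrite ltr_wpDl// enorm_ge0.
have gM : 0 < g / (2 * M) by rewrite divr_gt0// mulr_gt0.
pose near_out := [set v | exists y,
  ~ K y /\ enorm (y - a) < g / 2 /\ nrm y = v].
have Fnear : (nrm @ within (~` K) (nbhs a)) near_out.
  change (nbhs a [set y | ~ K y -> near_out (nrm y)]).
  apply/nbhs_enormP; exists (g / 2); first by rewrite divr_gt0.
  by move=> y ya Ky; exists y.
have [w' [[y [Ky [ya yw']]] w'w]] := cw _ _ Fnear (nbhs_enorm w gM).
have [/= Sy hy] := nrmP _ Ky; have := hy x Kx; rewrite -subr_le0 -dotBl.
have -> : dot (x - y) (nrm y) =
    g + dot (x - a) (nrm y - w) - dot (y - a) (nrm y).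
  by rewrite /g !dotE; ring.
rewrite yw' => h.
have h1 := dot_ge_enorm (x - a) (w' - w).
have h2 := dot_le_enorm (y - a) w'.
rewrite -{2}yw' Sy mulr1 in h2.
have h3 : enorm (x - a) * enorm (w' - w) <= g / 2.
  rewrite (@le_trans _ _ (M * (g / (2 * M))))//.
    by rewrite ler_pM ?enorm_ge0 ?lerDl ?(ltW w'w).
  have -> : M * (g / (2 * M)) = g / 2 by field; rewrite gt_eqF.
  exact: lexx.
rewrite /= in ya; lra.
Qed.

End Faces.

(** * Hausdorff perturbations of convex curves *)

Section Perturbation.
Context {R : realType}.
Implicit Types (p q w x y z a b P : plane R) (A K : set (plane R)).
Implicit Types (C D L : convex_curve R) (k l e : R).

Lemma boundary_compact K : compact K -> boundary K = K `\` K°.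
Proof. by move=> /compactK_closed/closure_id cK; rewrite /boundary -cK. Qed.

Lemma face_boundary K w : compact K -> w != 0 -> face K w `<=` boundary K.
Proof.
move=> cK w0 p pf; rewrite boundary_compact//; split; first exact: pf.1.
exact: face_not_interior pf.
Qed.

Lemma face_boundaryE K w : compact K -> K !=set0 -> w != 0 ->
  face (boundary K) w = face K w.
Proof.
move=> cK K0 w0; have bK := boundary_compact cK.
apply/seteqP; split=> p pf.
  have [q qf] := face_nonempty w cK K0.
  split; first by have [] := pf; rewrite bK => -[].
  by move=> x /qf.2/le_trans; apply; apply: pf.2; exact: face_boundary qf.
split; first exact: face_boundary pf.
by move=> x; rewrite bK => -[/pf.2].
Qed.

(** A curve and a body that it bounds have the same outward normals, so that
    normals may be computed on either. *)
Lemma curve_body C : exists K, [/\ compact K, convex_set K, K° !=set0,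
  (C : set (plane R)) = K `\` K° & forall w, w != 0 -> face C w = face K w].
Proof.
have [K [cK vK K0 CK]] := curve_setP C.
exists K; split=> //; first by rewrite CK boundary_compact.
move=> w w0; rewrite CK face_boundaryE//.
by have [x] := K0; exists x; exact: interior_subset.
Qed.

Lemma curve_compact C : compact (C : set (plane R)).
Proof.
have [K [cK _ _ CK _]] := curve_body C.
apply: (subclosed_compact _ cK) => [|x]; last by rewrite CK => -[].
exact: convex_curve_closed.
Qed.

Lemma curve_face_nonempty C w : face C w !=set0.
Proof.
by apply: face_nonempty; [exact: curve_compact|exact: convex_curve_neq0].
Qed.

(** A point of the inner boundary is pushed outwards along a normal until it
    leaves the larger body; a point of the outer boundary is projected on the
    smaller body. *)
Lemma hausdorff_dist_nested C D K K' e : compact K -> convex_set K ->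
  K° !=set0 -> compact K' -> convex_set K' -> K `<=` K' ->
  (C : set (plane R)) = boundary K -> (D : set (plane R)) = boundary K' ->
  0 <= e -> (forall y, K' y -> exists2 x, K x & enorm (x - y) <= e) ->
  hausdorff_dist C D <= e.
Proof.
move=> cK vK K0 cK' vK' KK' CK DK' e0 near.
have {}K0 : K !=set0 by have [x /interior_subset] := K0; exists x.
apply: ge_inf; first by exists 0; exact: hausdorff_bounds_lb.
split=> // [a|b]; rewrite CK DK' !boundary_compact//.
- move=> [Ka Kia]; have [w w0 wf] := supporting_normal cK vK Ka Kia.
  (* The chord of [K'] through [a] in the direction [w]. *)
  pose A := K' `&` [set x | dot x (rot w) = dot a (rot w)].
  have cA : compact A.
    apply: (subclosed_compact _ cK'); last by move=> x [].
    apply: closedI; first exact: compactK_closed.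
    apply: (@closed_comp _ _ (dot ^~ (rot w)) [set dot a (rot w)]).
      by move=> x _; exact: dot_continuous.
    exact: closed_eq.
  have Aa : A a by split=> //; exact: KK'.
  have [|b [K'b /= bw] bm] := compact_attains_max cA _ (@dot_continuous R w).
    by exists a.
  exists b; first split=> //.
    move=> /(@interior_step _ _ _ w)[d d0 K'd].
    have : A (b + d *: w).
      by split=> //=; rewrite dotDl dotZl dot_rotr mulr0 addr0.
    move=> /bm; rewrite dotDl dotZl gerDl pmulr_rle0// leNgt.
    by rewrite dot_gt0.
  have [x Kx xb] := near b K'b.
  rewrite /edist enormB; have nw := enorm_gt0 w0.
  rewrite -(ler_pM2r nw).
  have abw : 0 <= dot (b - a) w by rewrite dotBl subr_ge0 bm.
  have -> : enorm (b - a) * enorm w = dot (b - a) w.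
    have bar : dot (b - a) (rot w) = 0 by rewrite dotBl bw subrr.
    apply/eqP; rewrite -(@eqrXn2 _ 2)// ?mulr_ge0 ?enorm_ge0//.
    by rewrite exprMn !sqr_enorm -lagrange_identity bar expr0n addr0.
  have := wf.2 _ Kx; have := dot_le_enorm (b - x) w.
  rewrite enormB in xb; have := ler_wpM2r (ltW nw) xb.
  rewrite !dotBl; lra.
- move=> [K'b K'ib]; have [x Kx xb] := near b K'b.
  have [Kb|Kb] := pselect (K b).
    exists b; last by rewrite edistxx.
    by split=> // ib; apply: K'ib; exact: interiorS ib.
  have [a Ka am] := nearest_point b cK K0.
  exists a; last exact: le_trans (am _ Kx) xb.
  split=> //; apply: (@face_not_interior _ _ (b - a)).
    by rewrite subr_eq0; apply: contra_notN Kb => /eqP ->.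
  exact: nearest_point_face.
Qed.

(** For [K] convex and nonempty this is the convex hull of [K] and [P]. *)
Definition adjoin K P : set (plane R) :=
  [set y | exists x l, [/\ K x, 0 <= l, l <= 1 & y = l *: P + (1 - l) *: x]].

Lemma adjoin_self K P x : K x -> adjoin K P P.
Proof.
by move=> Kx; exists x, 1; split=> //; rewrite subrr scale1r scale0r addr0.
Qed.

Lemma sub_adjoin K P : K `<=` adjoin K P.
Proof.
by move=> x Kx; exists x, 0; split=> //; rewrite subr0 scale1r scale0r add0r.
Qed.

Lemma adjoin_compact K P : compact K -> compact (adjoin K P).
Proof.
move=> cK.
pose f (u : plane R * R) : plane R := u.2 *: P + (1 - u.2) *: u.1.
have -> : adjoin K P = f @` (K `*` `[0, 1]).
  apply/seteqP; split=> [y [x [l [Kx l0 l1 ->]]]|_ [[x l] [/= Kx l01] <-]].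
    by exists (x, l) => //; split=> //=; rewrite in_itv/= l0 l1.
  by move: l01; rewrite in_itv/= => /andP[l0 l1]; exists x, l.
apply: continuous_compact; last first.
  by apply: compact_setX => //; exact: segment_compact.
apply: continuous_subspaceT => u.
apply: cvgD; first by apply: cvgZr_tmp; exact: cvg_snd.
apply: cvgZ; last exact: cvg_fst.
by apply: cvgB; [exact: cvg_cst|exact: cvg_snd].
Qed.

Lemma adjoin_convex K P : convex_set K -> convex_set (adjoin K P).
Proof.
move=> vK; apply: convex_setI01.
move=> _ _ t [x1 [l1 [K1 l10 l11 ->]]] [x2 [l2 [K2 l20 l21 ->]]] t0 t1.
pose c1 := t * (1 - l1); pose c2 := (1 - t) * (1 - l2).
have c10 : 0 <= c1 by rewrite mulr_ge0// subr_ge0.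
have c20 : 0 <= c2 by rewrite mulr_ge0// subr_ge0.
have -> : t *: (l1 *: P + (1 - l1) *: x1) + (1 - t) *: (l2 *: P + (1 - l2) *: x2)
    = (1 - c1 - c2) *: P + (c1 *: x1 + c2 *: x2).
  by rewrite /c1 /c2; plane_ring.
have c12 : c1 + c2 <= 1 by rewrite /c1 /c2; nra.
have [c0|c0] := eqVneq (c1 + c2) 0.
  have -> : c1 = 0 by lra.
  have -> : c2 = 0 by lra.
  by rewrite !subr0 !scale0r !addr0 scale1r; exact: adjoin_self K1.
have cp : 0 < c1 + c2 by rewrite lt_neqAle eq_sym c0 addr_ge0.
pose s := c1 / (c1 + c2).
have s0 : 0 <= s by rewrite divr_ge0// ltW.
have s1 : s <= 1 by rewrite ler_pdivrMr// mul1r lerDl.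
exists (s *: x1 + (1 - s) *: x2), (1 - c1 - c2); split.
- exact: convex_combination.
- lra.
- lra.
- congr (_ + _); rewrite opprB opprD opprK.
  apply: plane_eqP; rewrite !mxE /s; field.
  + exact: c0.
  + exact: c0.
Qed.

(** Replacing [P] by [x0] in a convex combination moves it by at most their
    distance: adjoining a point close to [K] is a small perturbation. *)
Lemma adjoin_near K P x0 y : convex_set K -> K x0 -> adjoin K P y ->
  exists2 x, K x & enorm (x - y) <= enorm (P - x0).
Proof.
move=> vK Kx0 [x [l [Kx l0 l1 ->]]].
exists (l *: x0 + (1 - l) *: x); first exact: convex_combination.
have -> : l *: x0 + (1 - l) *: x - (l *: P + (1 - l) *: x) = l *: (x0 - P).
  by plane_ring.
by rewrite enormZ ger0_norm// (enormB P) ler_piMl ?enorm_ge0.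
Qed.

Lemma interior_adjoin K P : K° !=set0 -> (adjoin K P)° !=set0.
Proof. by move=> [x Kx]; exists x; apply: interiorS Kx; exact: sub_adjoin. Qed.

Lemma body_curve K : compact K -> convex_set K -> K° !=set0 ->
  exists D, (D : set (plane R)) = boundary K.
Proof.
move=> cK vK K0; have cc : is_convex_curve (boundary K) by exists K.
by exists (ConvexCurve cc).
Qed.

(** Capping the curve by a tip [P] raised above [x0] in the normal direction
    [w] creates a corner. The last conclusion says that [w] is interior to the
    normal cone at [P], with a margin [k] that makes the corner stable. *)
Lemma insert_corner C w x0 e : w != 0 -> face C w x0 -> 0 < e ->
  exists D P k, [/\ hausdorff_dist C D < e, D P, enorm (P - x0) < e, 0 < k &
    forall y, D y -> k * enorm (P - y) <= dot (P - y) w].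
Proof.
move=> w0 + e0.
have [K [cK vK K0 CK Cf]] := curve_body C; rewrite Cf// => -[Kx0 x0m].
have nw := enorm_gt0 w0; pose c := e / (2 * enorm w).
have c0 : 0 < c by rewrite divr_gt0// mulr_gt0.
pose P := x0 + c *: w.
have Px0 : enorm (P - x0) = e / 2.
  rewrite /P addrAC subrr add0r enormZ gtr0_norm// /c; field.
  by rewrite gt_eqF.
have [M M0 KM] := compact_enorm_bounded cK.
have cKP := adjoin_compact (P := P) cK; have vKP := adjoin_convex (P := P) vK.
have [D DE] := body_curve cKP vKP (interior_adjoin P K0).
have N0 : 0 < M + enorm P by rewrite ltr_wpDr ?enorm_ge0.
have gap x : K x -> c * dot w w <= dot (P - x) w.
  by move=> Kx; have := x0m _ Kx; rewrite /P dotBl dotDl dotZl; lra.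
have cw0 : 0 < c * dot w w by rewrite mulr_gt0// dot_gt0.
(* The tip is higher than the body by [c * dot w w] at least, while the body
   lies within [M + enorm P] of it. *)
pose k := c * dot w w / (M + enorm P).
have k0 : 0 < k by rewrite divr_gt0.
have cone y : adjoin K P y -> k * enorm (P - y) <= dot (P - y) w.
  move=> [x [l [Kx l0 l1 ->]]].
  have -> : P - (l *: P + (1 - l) *: x) = (1 - l) *: (P - x) by plane_ring.
  rewrite enormZ dotZl ger0_norm ?subr_ge0// mulrCA ler_wpM2l ?subr_ge0//.
  apply: le_trans (gap x Kx); rewrite /k mulrAC ler_pdivrMr//.
  rewrite ler_pM2l//.
  by rewrite (le_trans (enormD _ _))// enormN addrC lerD2r KM.
exists D, P, k; split=> //.
- rewrite (@le_lt_trans _ _ (e / 2))//; last by lra.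
  apply: (hausdorff_dist_nested cK vK K0 cKP vKP) => //.
  + exact: sub_adjoin.
  + by rewrite CK boundary_compact.
  + by rewrite divr_ge0// ltW.
  + by move=> y /(adjoin_near vK Kx0); rewrite Px0.
- rewrite DE; apply: (face_boundary cKP w0); split; first exact: adjoin_self Kx0.
  move=> y /cone h; rewrite -subr_ge0 -dotBl (le_trans _ h)//.
  by rewrite mulr_ge0 ?enorm_ge0// ltW.
- by rewrite Px0; lra.
- by move=> y; rewrite DE boundary_compact// => -[/cone].
Qed.

(** Raising [P] above the curve in the direction [w] and then adjoining its
    neighbour [Q] at the same height makes the segment from [P] to [Q] an edge
    with normal [w]. *)
Lemma insert_edge C w e : w != 0 -> 0 < e ->
  exists D P c, [/\ hausdorff_dist C D < e, 0 < c, face D w P &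
    face D w (P + c *: rot w)].
Proof.
move=> w0 e0; have [x0] := curve_face_nonempty C w.
have [K [cK vK K0 CK Cf]] := curve_body C; rewrite Cf// => -[Kx0 x0m].
have nw := enorm_gt0 w0; pose c := e / (4 * enorm w).
have c0 : 0 < c by rewrite divr_gt0// mulr_gt0.
have cw : c * enorm w = e / 4 by rewrite /c; field; rewrite gt_eqF.
pose P := x0 + c *: w; pose Q := P + c *: rot w.
pose KP := adjoin K P.
have cKP : compact KP by exact: adjoin_compact.
have vKP : convex_set KP by exact: adjoin_convex.
have KPP : KP P by exact: adjoin_self Kx0.
pose KQ := adjoin KP Q.
have cKQ : compact KQ by exact: adjoin_compact.
have vKQ : convex_set KQ by exact: adjoin_convex.
have KKQ : K `<=` KQ by move=> x Kx; do 2 apply: sub_adjoin.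
have KQ0 : KQ° !=set0 by apply: interior_adjoin; exact: interior_adjoin.
have [D DE] := body_curve cKQ vKQ KQ0.
have QP : dot Q w = dot P w by rewrite /Q dotDl dotZl dot_rotl mulr0 addr0.
have KPm x : KP x -> dot x w <= dot P w.
  move=> [y [l [Ky l0 l1 ->]]]; rewrite dotDl !dotZl.
  have := x0m _ Ky; have : dot x0 w <= dot P w.
    by rewrite /P dotDl dotZl lerDl mulr_ge0// ?dot_ge0// ltW.
  nra.
have KQm x : KQ x -> dot x w <= dot P w.
  move=> [y [l [Ky l0 l1 ->]]]; rewrite dotDl !dotZl QP.
  by have := KPm _ Ky; nra.
have fP : face KQ w P by split=> //; exact: sub_adjoin.
have fQ : face KQ w Q.
  by split=> [|x]; [exact: adjoin_self KPP|rewrite QP; exact: KQm].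
have fD : face D w = face KQ w.
  by rewrite DE face_boundaryE//; exists P; exact: fP.1.
exists D, P, c; rewrite fD; split=> //; rewrite (@le_lt_trans _ _ (e / 2))//; last by lra.
apply: (hausdorff_dist_nested cK vK K0 cKQ vKQ) => //.
- by rewrite CK boundary_compact.
- by rewrite divr_ge0// ltW.
- move=> y /(adjoin_near vKP KPP)[x /(adjoin_near vK Kx0)[x' Kx' x'x] xy].
  exists x' => //; rewrite -[x' - y](subrKA x) (le_trans (enormD _ _))//.
  have -> : e / 2 = e / 4 + e / 4 by field.
  rewrite lerD//.
  + by rewrite (le_trans x'x)// /P addrAC subrr add0r enormZ gtr0_norm// cw.
  + rewrite (le_trans xy)// /Q addrAC subrr add0r enormZ gtr0_norm//.
    by rewrite enorm_rot cw.
Qed.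

Lemma hausdorff_close C D e : hausdorff_dist C D < e ->
  (forall p, C p -> exists2 q, D q & enorm (p - q) < e) /\
  (forall q, D q -> exists2 p, C p & enorm (p - q) < e).
Proof.
move=> /hausdorff_dist_adherent[d [_ CD DC] de]; split.
- by move=> p /CD[q Dq pq]; exists q => //; exact: le_lt_trans pq de.
- by move=> q /DC[p Cp pq]; exists p => //; exact: le_lt_trans pq de.
Qed.

(** A point of [L] that is extreme in the direction [w] is close to a point of
    [D] almost as high as the tip, and the cone condition brings it to the
    tip. *)
Lemma corner_stable D L P w k e p : 0 < k -> D P ->
  (forall y, D y -> k * enorm (P - y) <= dot (P - y) w) ->
  hausdorff_dist D L < e -> face L w p ->
  k * enorm (P - p) <= e * (k + 2 * enorm w).
Proof.
move=> k0 DP cone /hausdorff_close[DL LD] [Lp pm].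
have [P' LP' PP'] := DL _ DP; have [y Dy yp] := LD _ Lp.
have h1 := pm _ LP'; have h2 := cone _ Dy.
have h3 := dot_le_enorm (P - P') w; have h4 := dot_ge_enorm (y - p) w.
have h5 : enorm (P - p) <= enorm (P - y) + enorm (y - p).
  by rewrite -[P - p](subrKA y) enormD.
have nw := enorm_ge0 w.
rewrite !dotBl in h2 h3 h4; nra.
Qed.

(** Tilting the direction from [w] to [w + c *: v] moves the extreme points of
    a nearby curve, up to a small error, beyond the whole face of [D] in the
    sense of [c *: v]; with both signs of [c] this detects long edges. *)
Lemma edge_stable D L P w v c e p : face D w P ->
  hausdorff_dist D L < e -> face L (w + c *: v) p ->
  c * dot (P - p) v <= e * (enorm w + enorm (w + c *: v)).
Proof.
move=> [DP Pm] /hausdorff_close[DL LD] [Lp pm].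
have [P' LP' PP'] := DL _ DP; have [y Dy yp] := LD _ Lp.
have h1 := pm _ LP'; have h2 := Pm _ Dy.
have h3 := dot_le_enorm (P - P') (w + c *: v).
have h4 := dot_ge_enorm (y - p) w.
have nw := enorm_ge0 w; have nv := enorm_ge0 (w + c *: v).
have h5 := ler_wpM2r nw (ltW yp); have h6 := ler_wpM2r nv (ltW PP').
rewrite !dotBl !dotDr !dotZr in h1 h3 h4 *; lra.
Qed.

End Perturbation.

(** * Typical convex curves *)

Section Category.
Context {T : topologicalType}.
Implicit Types (A S : set T).

(** A set is nowhere dense as soon as each of its points can be perturbed
    stably out of it. *)
Lemma nowhere_dense_perturb A :
  (forall x U, A x -> nbhs x U -> exists2 y, U y & nbhs y (~` A)) ->
  nowhere_dense A.
Proof.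
move=> h; apply/seteqP; split=> // x xA.
have [y [Ay iy]] := interior_subset xA _ (nbhs_interior xA).
have [z iz nz] := h _ _ Ay iy.
by have [t []] := iz _ nz.
Qed.

Lemma comeagre_superset A S : A `<=` S -> comeagre A -> comeagre S.
Proof.
move=> AS [F [Fn AF]]; exists F; split=> // x nS; apply: AF => Ax.
exact: nS (AS _ Ax).
Qed.

Lemma comeagre_countable (I : countType) (G : I -> set T) S :
  (forall i, nowhere_dense (~` G i)) -> \bigcap_i G i `<=` S -> comeagre S.
Proof.
move=> hG GS.
exists (fun n => if unpickle n is Some i then ~` G i else set0); split.
  move=> n; case: unpickle => [i|]; first exact: hG.
  by rewrite /nowhere_dense closure0 interior0.
move=> x nS; apply: contrapT => h; apply: nS; apply: GS => i _.
by apply: contrapT => nG; apply: h; exists (pickle i); rewrite ?pickleK.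
Qed.

End Category.

Section Typical.
Context {R : realType}.
Implicit Types (p q w x y z E P : plane R) (A : set (plane R)).
Implicit Types (C D L : convex_curve R) (N a b e r : R).

Lemma enorm_le_coord p : enorm p <= `|p ord0 ord0| + `|p ord0 ord_max|.
Proof.
rewrite -(@ler_pXn2r _ 2)// ?nnegrE ?enorm_ge0 ?addr_ge0//.
rewrite sqr_enorm dot2E -!expr2 -(real_normK (num_real (p ord0 ord0))).
rewrite -(real_normK (num_real (p ord0 ord_max))).
have := mulr_ge0 (normr_ge0 (p ord0 ord0)) (normr_ge0 (p ord0 ord_max)).
by nra.
Qed.

Definition vec2 a b : plane R := \row_i (if i == ord0 then a else b).

(** The four unit vectors of the axes, repeated with period four. *)
Definition axis (k : nat) : plane R := iter k rot (vec2 1 0).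

Lemma axis_unit k : dot (axis k) (axis k) = 1.
Proof.
elim: k => [|k IH]; first by rewrite dot2E !mxE /=; ring.
by rewrite /axis iterS dot_rot.
Qed.

(** Affine chart of directions: [normal E] runs over the open half-circle of
    directions centred at the unit vector [E], up to positive factors. Unlike
    an angle it makes differences of normals linear in the parameter. *)
Definition normal E r : plane R := E + r *: rot E.

Lemma dot_normal E r s : dot E E = 1 ->
  dot (normal E r) (normal E s) = 1 + r * s.
Proof.
move=> E1; rewrite /normal !dotE dot_rot dot_rotr dot_rotl E1; ring.
Qed.

Lemma normal_neq0 E r : dot E E = 1 -> normal E r != 0.
Proof.
move=> E1; apply/eqP => h; have := dot_normal r r E1; rewrite h dot0l.
by move/eqP; rewrite eq_sym gt_eqF// ltr_pwDl// -expr2 sqr_ge0.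
Qed.

Lemma normalD E r s : normal E (r + s) = normal E r + s *: rot E.
Proof. by rewrite /normal scalerDl addrA. Qed.

Lemma axis_cover w : w != 0 ->
  exists k r c, [/\ 0 < c & w = c *: normal (axis k) r].
Proof.
move=> w0.
have [k wk] : exists k, 0 < dot w (axis k).
  have [h|h|h] := ltrgtP 0 (w ord0 ord0).
  - by exists 0%N; rewrite dot2E !mxE /=; lra.
  - by exists 2%N; rewrite dot2E !mxE /=; lra.
  - have [g|g|g] := ltrgtP 0 (w ord0 ord_max).
    + by exists 1%N; rewrite dot2E !mxE /=; lra.
    + by exists 3%N; rewrite dot2E !mxE /=; lra.
    + by case/eqP: w0; apply: plane_eqP; rewrite mxE.
exists k, (dot w (rot (axis k)) / dot w (axis k)), (dot w (axis k)).
split=> //; have := frameE (axis k) w; rewrite axis_unit scale1r => {1}->.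
by rewrite /normal scalerDr scalerA mulrCA divff ?gt_eqF// mulr1.
Qed.

(** For large [N] the contact points are far apart in comparison with their
    normals: the curve is almost flat there. *)
Definition stretched A E N a b := exists s t p q,
  [/\ [/\ a < s, s < t & t < b], face A (normal E s) p, face A (normal E t) q &
    N * (t - s) < dot (q - p) (rot E)].

(** For large [N] the normals are far apart in comparison with their contact
    points: the curve is almost cornered there. *)
Definition squeezed A E N a b := exists s t p q,
  [/\ [/\ a < s, s < t & t < b], face A (normal E s) p, face A (normal E t) q &
    N * dot (q - p) (rot E) < t - s].

(** No disc centred at an interior point of an edge, and small enough, has this
    property: the normals supported near such a point are those of the edge. *)
Definition pointed A x r := exists2 w, w != 0 &
  forall p, face A w p -> enorm (p - x) < r.

(** An inserted edge survives small perturbations as a stretched pair. *)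
Lemma stretched_dense C E N a b e : dot E E = 1 -> 0 <= N -> a < b -> 0 < e ->
  exists D d, [/\ hausdorff_dist C D < e, 0 < d &
    forall L, hausdorff_dist D L < d -> stretched L E N a b].
Proof.
move=> E1 N0 ab e0; pose r := (a + b) / 2; pose w := normal E r.
have w0 : w != 0 by exact: normal_neq0.
have [D [P [c [CD c0 fP fQ]]]] := insert_edge C w0 e0.
(* Between the normals at distance [h] on both sides of its own, the edge makes
   the contact point move by about [c], which has to exceed [N * (2 * h)]. *)
pose h := Num.min ((b - a) / 4) (c / (4 * (N + 1))).
have h0 : 0 < h.
  by rewrite /h lt_min !divr_gt0// ?subr_gt0// mulr_gt0// ltr_wpDl.
have h1 : h <= (b - a) / 4 by rewrite /h ge_min lexx.
have h2 : h * (4 * (N + 1)) <= c.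
  by rewrite -ler_pdivlMr ?mulr_gt0 ?ltr_wpDl// /h ge_min lexx orbT.
pose B := enorm w + enorm (w + (- h) *: rot E) +
  (enorm w + enorm (w + h *: rot E)).
have B0 : 0 <= B by rewrite !addr_ge0// enorm_ge0.
exists D, (h * c / (2 * (B + 1))); split=> //.
  by rewrite divr_gt0// ?mulr_gt0// ltr_wpDl.
move=> L DL.
have [p pf] := curve_face_nonempty L (normal E (r + - h)).
have [q qf] := curve_face_nonempty L (normal E (r + h)).
exists (r + - h), (r + h), p, q; split=> //; first by rewrite /r; split; lra.
have := pf; rewrite normalD => /(edge_stable fP DL) hp.
have := qf; rewrite normalD => /(edge_stable fQ DL) hq.
have dB : h * c / (2 * (B + 1)) * B <= h * c / 2.
  rewrite mulrAC ler_pdivrMr ?mulr_gt0 ?ltr_wpDl//.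
  have -> : h * c / 2 * (2 * (B + 1)) = h * c * (B + 1) by field.
  by rewrite ler_pM2l ?mulr_gt0// lerDl.
have PQ : dot (rot w) (rot E) = 1.
  by rewrite dot_rot /w /normal dotDl dotZl dot_rotl E1 mulr0 addr0.
rewrite -(ltr_pM2l h0).
have : h * dot (q - p) (rot E) >= h * c - h * c / (2 * (B + 1)) * B.
  move: hp hq; rewrite /B !dotBl dotDl dotZl PQ; lra.
have : h * (h * (4 * (N + 1))) <= h * c by rewrite ler_pM2l.
have : 0 < h * h by rewrite mulr_gt0.
rewrite (_ : r + h - (r + - h) = 2 * h); last by ring.
by move: dB; rewrite -!mulrA; nra.
Qed.

(** An inserted corner survives small perturbations as a squeezed pair. *)
Lemma squeezed_dense C E N a b e : dot E E = 1 -> 0 <= N -> a < b -> 0 < e ->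
  exists D d, [/\ hausdorff_dist C D < e, 0 < d &
    forall L, hausdorff_dist D L < d -> squeezed L E N a b].
Proof.
move=> E1 N0 ab e0; pose r := (a + b) / 2; pose w := normal E r.
have w0 : w != 0 by exact: normal_neq0.
have [x0 x0f] := curve_face_nonempty C w.
have [D [P [k [CD DP _ k0 cone]]]] := insert_corner w0 x0f e0.
have nE : enorm (rot E) = 1 by rewrite enorm_rot /enorm E1 sqrtr1.
(* The normals within [k / 2] of [w] still have a margin [k / 2] at the tip. *)
pose h := Num.min ((b - a) / 4) (k / 2).
have h0 : 0 < h by rewrite /h lt_min !divr_gt0// subr_gt0.
have h1 : h <= (b - a) / 4 by rewrite /h ge_min lexx.
have h2 : h <= k / 2 by rewrite /h ge_min lexx orbT.
pose v := w + h *: rot E.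
have conev y : D y -> k / 2 * enorm (P - y) <= dot (P - y) v.
  move=> /cone ky; rewrite /v dotDr dotZr.
  have := dot_ge_enorm (P - y) (rot E); rewrite nE mulr1.
  by have := enorm_ge0 (P - y); nra.
pose B := (k + 2 * enorm w) + (k + 4 * enorm v).
have B0 : 0 < B by rewrite addr_gt0// ltr_pwDl// mulr_ge0// enorm_ge0.
pose d := k * h / ((N + 1) * B).
have N1 : 0 < N + 1 by rewrite ltr_wpDl.
have d0 : 0 < d by rewrite divr_gt0// mulr_gt0.
exists D, d; split=> // L DL.
have [p pf] := curve_face_nonempty L (normal E r).
have [q qf] := curve_face_nonempty L (normal E (r + h)).
exists r, (r + h), p, q; split=> //; first by rewrite /r; split; lra.
have hp := corner_stable k0 DP cone DL pf.
have k20 : 0 < k / 2 by rewrite divr_gt0.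
have qv : face L v q by rewrite /v /w -normalD.
have hq := corner_stable k20 DP conev DL qv.
have pq : dot (q - p) (rot E) <= enorm (P - p) + enorm (P - q).
  rewrite (le_trans (dot_le_enorm _ _))// nE mulr1.
  by rewrite -[q - p](subrKA P) addrC (le_trans (enormD _ _))// (enormB q).
have kpq : k * dot (q - p) (rot E) <= d * B.
  have := ler_wpM2l (ltW k0) pq; move: hp hq; rewrite /B; lra.
have dB : d * B * (N + 1) = k * h.
  by rewrite /d; field; rewrite !gt_eqF.
rewrite (_ : r + h - r = h); last by ring.
rewrite -(ltr_pM2l k0).
have kh : 0 < k * h by rewrite mulr_gt0.
have : k * dot (q - p) (rot E) * N <= d * B * N by rewrite ler_wpM2r.
have : 0 < d * B by rewrite mulr_gt0.
lra.
Qed.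

Lemma curve_normal C x : C x -> exists2 w, w != 0 & face C w x.
Proof.
have [K [cK vK K0 CK Cf]] := curve_body C => Cx.
have [Kx Kix] : (K `\` K°) x by rewrite -CK.
by have [w w0 wf] := supporting_normal cK vK Kx Kix; exists w; rewrite ?Cf.
Qed.

Lemma pointed_dense C x y r e : C y -> enorm (y - x) < r -> 0 < e ->
  exists D d, [/\ hausdorff_dist C D < e, 0 < d &
    forall L, hausdorff_dist D L < d -> pointed L x r].
Proof.
move=> Cy yx e0; have [w w0 wf] := curve_normal Cy.
pose e' := Num.min e (r - enorm (y - x)).
have e'0 : 0 < e' by rewrite lt_min e0 subr_gt0.
have [D [P [k [CD DP Py k0 cone]]]] := insert_corner w0 wf e'0.
have Pr : enorm (P - x) < r.
  rewrite -[P - x](subrKA y) (le_lt_trans (enormD _ _))// -ltrBrDr.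
  by rewrite (lt_le_trans Py)// ge_min lexx orbT.
pose B := k + 2 * enorm w.
have B0 : 0 < B by rewrite ltr_pwDl// mulr_ge0// enorm_ge0.
pose d := k * (r - enorm (P - x)) / (2 * B).
have d0 : 0 < d by rewrite divr_gt0 ?mulr_gt0// subr_gt0.
exists D, d; split=> //; first by rewrite (lt_le_trans CD)// ge_min lexx.
move=> L DL; exists w => // p /(corner_stable k0 DP cone DL); rewrite -/B.
have -> : d * B = k * ((r - enorm (P - x)) / 2).
  by rewrite /d; field; rewrite gt_eqF.
rewrite ler_pM2l// => Pp.
have : enorm (p - x) <= enorm (P - p) + enorm (P - x).
  by rewrite -[p - x](subrKA P) (enormB P p) enormD.
lra.
Qed.

(** For fixed parameters each condition fails only on a nowhere dense set of
    curves. The first two give the curvature its oscillations; the first also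
    excludes corners and the third excludes edges. *)
Definition typical C := [/\
  forall k N a b, 0 <= N -> a < b -> stretched C (axis k) N a b,
  forall k N a b, 0 <= N -> a < b -> squeezed C (axis k) N a b &
  forall x r, C x -> 0 < r -> pointed C x r].

Lemma nbhs_hausdorffP C (U : set (convex_curve R)) :
  nbhs C U <-> exists2 e, 0 < e & forall D, hausdorff_dist C D < e -> U D.
Proof. by split=> /nbhs_ballP. Qed.

Lemma nowhere_dense_hausdorff (A : set (convex_curve R)) :
  (forall C e, A C -> 0 < e -> exists D d, [/\ hausdorff_dist C D < e, 0 < d &
    forall L, hausdorff_dist D L < d -> ~ A L]) ->
  nowhere_dense A.
Proof.
move=> h; apply: nowhere_dense_perturb => C U AC /nbhs_hausdorffP[e e0 eU].
have [D [d [CD d0 dA]]] := h C e AC e0.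
by exists D; [exact: eU|apply/nbhs_hausdorffP; exists d].
Qed.

Lemma rat_subitv a b : a < b ->
  exists u v : rat, [/\ u < v, a < ratr u & ratr v < b].
Proof.
move=> ab; have [u] := rat_in_itvoo ab; rewrite in_itv/= => /andP[au ub].
have [v] := rat_in_itvoo ub; rewrite in_itv/= => /andP[uv vb].
by exists u, v; rewrite -(ltr_rat R).
Qed.

(** Real parameters reduce to rational ones: shrink the interval and the disc,
    and increase [N]. *)
Theorem typical_comeagre : comeagre [set C | typical C].
Proof.
pose idx := ((nat * rat * rat * nat) + (nat * rat * rat * nat) +
  (rat * rat * rat))%type.
pose G (i : idx) : set (convex_curve R) := [set C | match i with
  | inl (inl (k, u, v, n)) => u < v ->
      stretched C (axis k) n%:R (ratr u) (ratr v)
  | inl (inr (k, u, v, n)) => u < v ->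
      squeezed C (axis k) n%:R (ratr u) (ratr v)
  | inr (c1, c2, s) =>
      (exists2 y, C y & enorm (y - vec2 (ratr c1) (ratr c2)) < ratr s) ->
      pointed C (vec2 (ratr c1) (ratr c2)) (ratr s) end].
apply: (@comeagre_countable _ idx G).
  move=> [[[[[k u] v] n]|[[[k u] v] n]]|[[c1 c2] s]];
    apply: nowhere_dense_hausdorff => C e /not_implyP.
  - move=> [uv _] e0.
    have uvR : ratr u < ratr v :> R by rewrite ltr_rat.
    have [D [d [CD d0 h]]] := stretched_dense C (axis_unit k) (ler0n R n) uvR e0.
    by exists D, d; split=> // L /h hL; apply.
  - move=> [uv _] e0.
    have uvR : ratr u < ratr v :> R by rewrite ltr_rat.
    have [D [d [CD d0 h]]] := squeezed_dense C (axis_unit k) (ler0n R n) uvR e0.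
    by exists D, d; split=> // L /h hL; apply.
  - move=> [[y Cy ys] _] e0.
    have [D [d [CD d0 h]]] := pointed_dense Cy ys e0.
    by exists D, d; split=> // L /h hL; apply.
move=> C GC; split.
- move=> k N a b N0 /rat_subitv[u [v [uv au vb]]].
  have [n Nn] : exists n : nat, N < n%:R.
    by exists (Num.bound N); rewrite archi_boundP.
  have [s [t [p [q [[us st tv] pf qf pq]]]]] :=
    GC (inl (inl (k, u, v, n))) I uv.
  exists s, t, p, q; split=> //.
    by split=> //; [exact: lt_trans us|exact: lt_trans vb].
  by apply: le_lt_trans pq; apply: ler_wpM2r; rewrite ?subr_ge0 ltW.
- move=> k N a b N0 /rat_subitv[u [v [uv au vb]]].
  have [n Nn] : exists n : nat, N < n%:R.
    by exists (Num.bound N); rewrite archi_boundP.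
  have [s [t [p [q [[us st tv] pf qf pq]]]]] :=
    GC (inl (inr (k, u, v, n))) I uv.
  exists s, t, p, q; split=> //.
    by split=> //; [exact: lt_trans us|exact: lt_trans vb].
  have [pq0|pq0] := leP 0 (dot (q - p) (rot (axis k))).
    by apply: le_lt_trans pq; apply: ler_wpM2r; rewrite ?pq0 // ltW.
  by rewrite (@le_lt_trans _ _ 0) ?subr_gt0// mulr_ge0_le0// ltW.
- move=> x r Cx r0.
  have r8 : 0 < r / 8 by rewrite divr_gt0.
  have near i : exists c : rat, `|x ord0 i - ratr c| < r / 8.
    have [|c] := @rat_in_itvoo _ (x ord0 i - r / 8) (x ord0 i); first lra.
    rewrite in_itv/= => /andP[h1 h2]; exists c.
    by rewrite gtr0_norm ?subr_gt0//; lra.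
  have [c1 xc1] := near ord0; have [c2 xc2] := near ord_max.
  pose c := vec2 (ratr c1) (ratr c2).
  have xc : enorm (x - c) < r / 4.
    rewrite (le_lt_trans (enorm_le_coord _))// !mxE /=; lra.
  have [|s] := @rat_in_itvoo _ (r / 4) (r / 2); first lra.
  rewrite in_itv/= => /andP[s1 s2].
  have [|w w0 h] := GC (inr (c1, c2, s)) I.
    by exists x => //; exact: lt_trans s1.
  exists w => // p /h pc.
  rewrite -[p - x](subrKA c) (le_lt_trans (enormD _ _))// (enormB c).
  by move: pc; rewrite -/c; lra.
Qed.

End Typical.

(** * Strict convexity and smoothness of typical curves *)

Section TypicalGeometry.
Context {R : realType}.
Implicit Types (p q w x y z E P : plane R) (A : set (plane R)).
Implicit Types (C : convex_curve R) (a b e r s t : R).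

Lemma dot_orthogonal w d x y : dot d w = 0 -> w != 0 ->
  dot w w * dot d d * dot x y =
  dot d d * (dot x w * dot w y) + dot w w * (dot x d * dot d y).
Proof.
move=> dw w0; have ww := dot_gt0 w0.
have dE : d = (dot d (rot w) / dot w w) *: rot w.
  apply: (@scalerI _ _ (dot w w)); first by rewrite gt_eqF.
  by rewrite frameE dw scale0r add0r scalerA mulrCA divff ?gt_eqF// mulr1.
by rewrite dE; set c := _ / _; rewrite !dotZl !dotZr dot_rot !dot2E !mxE /=; ring.
Qed.

(** Otherwise the curve would lie on a line. *)
Lemma no_opposite_normals C w z : w != 0 -> face C w z -> ~ face C (- w) z.
Proof.
move=> w0; have [K [_ _ [ip Kip] _ Cf]] := curve_body C.
rewrite !Cf ?oppr_eq0// => -[_ h1] [_ h2].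
have [e e0 /h1] := interior_step w Kip; rewrite dotDl dotZl.
have := h2 _ (interior_subset Kip); rewrite !dotNr.
have := mulr_gt0 e0 (dot_gt0 w0); lra.
Qed.

(** If the face were a segment [p, q], a direction [w1] supported only near its
    midpoint would have to point inwards, since outward directions are
    supported at [p] or at [q]; but then the body, having interior points,
    sticks out of the halfplane that [w1] determines. *)
Lemma typical_face_unique C w p q : typical C -> w != 0 ->
  face C w p -> face C w q -> p = q.
Proof.
move=> [_ _ sharp] w0 pf qf; apply/eqP; apply/negPn/negP => pq.
have [K [cK vK [ip Kip] CK Cf]] := curve_body C.
pose d := q - p; have d0 : d != 0 by rewrite subr_eq0 eq_sym.
have dw : dot d w = 0 by rewrite /d dotBl (face_dot_eq pf qf) subrr.
move: pf qf; rewrite Cf// => -[Kp pm] [Kq qm].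
pose m := p + 2^-1 *: d.
have mE : m = 2^-1 *: p + (1 - 2^-1) *: q.
  by rewrite /m /d; apply: plane_eqP; rewrite !mxE; field.
have Km : K m by rewrite mE; apply: convex_combination => //; lra.
have mw : dot m w = dot p w by rewrite /m dotDl dotZl dw mulr0 addr0.
have Cm : C m.
  suff : face C w m by case.
  by rewrite Cf//; split=> // x /pm; rewrite mw.
have [h h0 hK] := (nbhs_enormP _ _).1 Kip.
have nd := enorm_gt0 d0; have dd := dot_gt0 d0; have ww := dot_gt0 w0.
(* The radius is less than the distance from [m] to both ends, and small enough
   to contradict the disc of radius [h] in the body. *)
pose S := enorm d + 2 * enorm (ip - m).
have S0 : 0 < S by rewrite ltr_pwDl// mulr_ge0// enorm_ge0.
pose r := Num.min (enorm d / 2) (h * enorm d / (4 * S)).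
have r0 : 0 < r by rewrite lt_min !divr_gt0// mulr_gt0.
have r1 : r <= enorm d / 2 by rewrite ge_min lexx.
have r2 : r * (4 * S) <= h * enorm d.
  by rewrite -ler_pdivlMr ?mulr_gt0// ge_min lexx orbT.
have [w1 w10 w1r] := sharp _ _ Cm r0.
have [f ff] := curve_face_nonempty C w1.
have fr := w1r _ ff; have n1 := enorm_gt0 w10.
have sharp' x : K x -> dot x w1 = dot f w1 -> enorm (x - m) < r.
  move=> Kx xf; apply: w1r; move: ff; rewrite !Cf// => -[_ fm].
  by split=> // y /fm; rewrite xf.
move: ff; rewrite Cf// => -[Kf fm].
have pmE : p - m = (- 2^-1) *: d by rewrite /m; plane_ring.
have qmE : q - m = 2^-1 *: d.
  by rewrite mE /d; apply: plane_eqP; rewrite !mxE; field.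
have far x : x - m = 2^-1 *: d \/ x - m = (- 2^-1) *: d -> ~ enorm (x - m) < r.
  move=> [] ->; rewrite enormZ ?normrN ger0_norm ?invr_ge0//; lra.
have fd : `|dot (f - m) d| <= dot d d / 2.
  rewrite (le_trans (normr_dot_le _ _))// -sqr_enorm expr2 mulrAC.
  by rewrite ler_pM2r// (le_trans (ltW fr)).
have fw : dot (f - m) w <= 0 by have := pm _ Kf; rewrite dotBl mw; lra.
(* [w1] outward: it is supported at the end towards which it leans. *)
have [w1w|w1w] := leP 0 (dot w w1).
  have [dw1|dw1] := leP (dot d w1) 0.
    apply: (far p); first by right.
    apply: sharp' => //; apply/le_anti; rewrite fm//= -subr_le0 -dotBl.
    have pfE : f - p = (f - m) + 2^-1 *: d by rewrite /m; plane_ring.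
    have := dot_orthogonal (f - p) w1 dw w0.
    have pw : dot (f - p) w <= 0 by rewrite pfE dotDl dotZl dw mulr0 addr0.
    have pd : 0 <= dot (f - p) d.
      by rewrite pfE dotDl dotZl; move: fd; rewrite ler_norml => /andP[]; lra.
    have h1 : dot (f - p) w * dot w w1 <= 0 by rewrite mulr_le0_ge0.
    have h2 : dot (f - p) d * dot d w1 <= 0 by rewrite mulr_ge0_le0.
    move=> h3; rewrite -(pmulr_rle0 _ (mulr_gt0 ww dd)) h3.
    have := mulr_ge0_le0 (ltW dd) h1; have := mulr_ge0_le0 (ltW ww) h2; lra.
  apply: (far q); first by left.
  apply: sharp' => //; apply/le_anti; rewrite fm//= -subr_le0 -dotBl.
  have qfE : f - q = (f - m) - 2^-1 *: d by rewrite -qmE; plane_ring.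
  have := dot_orthogonal (f - q) w1 dw w0.
  have qw : dot (f - q) w <= 0 by rewrite qfE dotDl dotNl dotZl dw mulr0 subr0.
  have qd : dot (f - q) d <= 0.
    rewrite qfE dotDl dotNl dotZl; move: fd; rewrite ler_norml => /andP[].
    lra.
  have h1 : dot (f - q) w * dot w w1 <= 0 by rewrite mulr_le0_ge0.
  have h2 : dot (f - q) d * dot d w1 <= 0 by rewrite mulr_le0_ge0// ltW.
  move=> h3; rewrite -(pmulr_rle0 _ (mulr_gt0 ww dd)) h3.
  have := mulr_ge0_le0 (ltW dd) h1; have := mulr_ge0_le0 (ltW ww) h2; lra.
(* [w1] inward: the disc around [ip] is too high for it. *)
have fw1 : dot f w1 <= dot m w1 + r * enorm w1.
  have := dot_le_enorm (f - m) w1; rewrite dotBl.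
  by have := ler_wpM2r (ltW n1) (ltW fr); lra.
have om : dot (ip - m) w1 + h / 2 * enorm w1 <= r * enorm w1.
  have : K (ip + (h / (2 * enorm w1)) *: w1).
    apply: hK; rewrite addrAC subrr add0r enormZ gtr0_norm ?divr_gt0 ?mulr_gt0//.
    by rewrite invfM mulrA mulfVK ?gt_eqF//; lra.
  move=> /fm; rewrite dotDl dotZl -sqr_enorm.
  have -> : h / (2 * enorm w1) * enorm w1 ^+ 2 = h / 2 * enorm w1.
    by field; rewrite gt_eqF.
  by rewrite dotBl; lra.
have dw1 : `|dot d w1| <= 2 * r * enorm w1.
  have qE : dot q w1 - dot m w1 = 2^-1 * dot d w1 by rewrite -dotZl -qmE dotBl.
  have pE : dot p w1 - dot m w1 = - 2^-1 * dot d w1.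
    by rewrite -dotZl -pmE dotBl.
  have := fm _ Kp; have := fm _ Kq => g1 g2.
  by rewrite ler_norml; apply/andP; split; lra.
have omw : dot (ip - m) w <= 0.
  by have := pm _ (interior_subset Kip); rewrite dotBl mw; lra.
have g1 := dot_orthogonal (ip - m) w1 dw w0.
have g2 : 0 <= dot (ip - m) w * dot w w1 by rewrite mulr_le0// ltW.
have g3 : dot (ip - m) d * dot d w1 <= dot d d * dot (ip - m) w1.
  by rewrite -(ler_pM2l ww) [leRHS]mulrA g1 lerDr mulr_ge0// dot_ge0.
have g4 : `|dot (ip - m) d * dot d w1| <=
    enorm (ip - m) * enorm d * (2 * r * enorm w1).
  by rewrite normrM ler_pM// normr_dot_le.
have g5 : h / 2 * enorm d <= r * S.
  rewrite -(ler_pM2r (mulr_gt0 nd n1)).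
  have := ler_wpM2l (ltW dd) om; move: g3 g4; rewrite -sqr_enorm ler_norml.
  by move=> ? /andP[? _]; rewrite /S; lra.
have := mulr_gt0 h0 nd; lra.
Qed.

End TypicalGeometry.
Section TangentLines.
Context {R : realType}.
Implicit Types (p q w x y z E P n : plane R) (A : set (plane R)).
Implicit Types (C : convex_curve R) (a b e r s t c : R).

Lemma face_cone A w w' z a b : 0 <= a -> 0 <= b -> face A w z -> face A w' z ->
  face A (a *: w + b *: w') z.
Proof.
move=> a0 b0 [Az h] [_ h']; split=> // x Ax.
by rewrite !dotDr !dotZr lerD// ler_wpM2l ?h ?h'.
Qed.

Lemma cramer w w' v : dot w (rot w') != 0 ->
  v = (dot v (rot w') / dot w (rot w')) *: w +
      (dot v (rot w) / dot w' (rot w)) *: w'.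
Proof.
have -> : dot w' (rot w) = - dot w (rot w') by rewrite !dot2E !mxE /=; ring.
rewrite !dot2E !mxE /= => h; apply: plane_eqP; rewrite !mxE; field; exact: h.
Qed.

(** Two non-parallel normals at the same point span a cone of normals there,
    and the interval of directions in this cone has no stretched pair. *)
Lemma typical_normal_unique C w w' z : typical C -> w != 0 -> w' != 0 ->
  face C w z -> face C w' z -> exists2 c, 0 < c & w' = c *: w.
Proof.
move=> tC w0 w'0 fw fw'; have [stretch _ _] := tC.
have ww := dot_gt0 w0.
have [par|npar] := eqVneq (dot w (rot w')) 0.
  have {}par : dot w' (rot w) = 0.
    by move: par; rewrite !dot2E !mxE /=; lra.
  have w'E : w' = (dot w' w / dot w w) *: w.
    apply: (@scalerI _ _ (dot w w)); first by rewrite gt_eqF.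
    by rewrite frameE par scale0r addr0 scalerA mulrCA divff ?gt_eqF// mulr1.
  move: (dot w' w / dot w w) w'E => c w'E; exists c => //.
  have [//|c0|c0] := ltrgtP 0 c; last first.
    by move: w'0; rewrite w'E -c0 scale0r eqxx.
  exfalso; apply: (no_opposite_normals w0 fw).
  apply/(@faceZ _ _ _ (- c)); first by rewrite oppr_gt0.
  by rewrite scalerN scaleNr opprK -w'E.
exfalso; set D := dot w (rot w') in npar.
have D'E : dot w' (rot w) = - D by rewrite /D !dot2E !mxE /=; ring.
have v0 : w + w' != 0.
  apply/eqP => /(congr1 (fun v => dot v (rot w'))).
  by rewrite dotDl dot_rotr addr0 dot0l => /eqP; rewrite (negbTE npar).
have [k [r [c [c0 vE]]]] := axis_cover v0.
set E := axis k in vE.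
pose M := `|dot (rot E) (rot w') / D| + `|dot (rot E) (rot w) / D|.
have M0 : 0 <= M by rewrite addr_ge0.
(* Within [h] of [r] the coefficients of [normal E s] on [w] and [w'], equal to
   [c^-1] at [r], stay nonnegative. *)
pose h := (c * (M + 1))^-1.
have h0 : 0 < h by rewrite invr_gt0 mulr_gt0// ltr_wpDl.
have hM : h * M <= c^-1.
  rewrite /h invfM -mulrA ler_piMr ?invr_ge0 ?(ltW c0)//.
  by rewrite ler_pdivrMl ?ltr_wpDl// mulr1 lerDl.
have inside s : r - h < s -> s < r + h -> face C (normal E s) z.
  move=> rs sr; rewrite (@cramer w w' (normal E s))//.
  have sE : normal E s = c^-1 *: (w + w') + (s - r) *: rot E.
    rewrite vE scalerA mulVf ?gt_eqF// scale1r -normalD; congr normal; ring.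
  have sr' : `|s - r| <= h by rewrite ler_norml; apply/andP; split; lra.
  have bnd (x : R) : `|x| <= M -> 0 <= c^-1 + (s - r) * x.
    move=> xM; have : `|(s - r) * x| <= h * M by rewrite normrM ler_pM.
    by rewrite ler_norml => /andP[]; lra.
  apply: face_cone => //.
    rewrite sE dotDl !dotZl dotDl dot_rotr addr0 -/D mulrDl mulfK//.
    by rewrite -mulrA bnd// lerDl.
  rewrite sE dotDl !dotZl dotDl dot_rotr add0r D'E.
  set X := dot (rot E) (rot w).
  have -> : (c^-1 * - D + (s - r) * X) / - D = c^-1 + (s - r) * - (X / D).
    by field; rewrite npar gt_eqF.
  by rewrite bnd// normrN lerDr.
have [|s [t [p [q [[rs st tr] pf qf]]]]] :=
  stretch k 0 (r - h) (r + h) (lexx _); first by lra.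
rewrite mul0r -/E.
have E1 : dot E E = 1 by exact: axis_unit.
rewrite (typical_face_unique tC (normal_neq0 _ E1) pf (inside s rs _)).
  rewrite (typical_face_unique tC (normal_neq0 _ E1) qf (inside t _ tr)).
    by rewrite subrr dot0l ltxx.
  exact: lt_trans st.
exact: lt_trans tr.
Qed.

Lemma supporting_lineP A z T : supporting_line A z T <->
  exists n, [/\ n != 0, T = line n (dot n z) & A `<=` half_plane n (dot n z)].
Proof.
split=> [[Tz [n [c [n0 TE Ac]]]]|[n [n0 -> An]]].
  have zc : dot n z = c by move: Tz; rewrite TE.
  by exists n; rewrite zc.
by split=> //; exists n, (dot n z).
Qed.

Lemma sub_half_plane C n z : C z ->
  (C : set (plane R)) `<=` half_plane n (dot n z) <-> face C n z.
Proof.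
move=> Cz; split=> [h|[_ h] x Cx]; last by rewrite /half_plane /= !(dotC n) h.
by split=> // x /h; rewrite /half_plane /= !(dotC n).
Qed.

Lemma typical_tangent C z : typical C -> C z ->
  exists! T, supporting_line C z T.
Proof.
move=> tC Cz; have [w w0 wf] := curve_normal Cz.
exists (line w (dot w z)); split.
  by apply/supporting_lineP; exists w; split=> //; exact/sub_half_plane.
move=> T /supporting_lineP[n [n0 -> /(sub_half_plane _ Cz) nf]].
have [c c0 ->] := typical_normal_unique tC w0 n0 wf nf.
apply/seteqP; split=> x; rewrite /line /= !dotZl; first by move=> ->.
by apply: mulfI; rewrite gt_eqF.
Qed.

(** On a strictly convex curve [face C (normal E s)] is a single point; this
    choice of it parametrizes an arc by the slope [s] of its normal. *)
Definition touch C E s : plane R := xget 0 (face C (normal E s)).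

Lemma touch_face C E s : face C (normal E s) (touch C E s).
Proof.
have [p pf] := curve_face_nonempty C (normal E s).
exact: (xgetI _ pf).
Qed.

Lemma touch_curve C E s : C (touch C E s).
Proof. by have [] := touch_face C E s. Qed.

Lemma touch_unique C E s p : typical C -> dot E E = 1 ->
  face C (normal E s) p -> p = touch C E s.
Proof.
move=> tC E1 pf.
exact: typical_face_unique tC (normal_neq0 s E1) pf (touch_face C E s).
Qed.

(** Injectivity expresses smoothness: no point carries two normals. *)
Lemma touch_inj C E : typical C -> dot E E = 1 -> injective (touch C E).
Proof.
move=> tC E1 s t st; have ft := touch_face C E t; rewrite -st in ft.
have [c c0] := typical_normal_unique tC (normal_neq0 s E1) (normal_neq0 t E1)
  (touch_face C E s) ft.
move=> h; have := congr1 (dot ^~ E) h; have := congr1 (dot ^~ (rot E)) h.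
rewrite /normal !dotE dot_rot dot_rotl dot_rotr E1; nra.
Qed.

(** Points of the curve far from the touching point at [s] stay strictly below
    the tangent line there, by compactness and strict convexity, hence are not
    touching points for nearby normals. *)
Lemma touch_continuous C E : typical C -> dot E E = 1 ->
  continuous (touch C E).
Proof.
move=> tC E1 s; apply/(@cvgrPdist_lt _ _ _ (nbhs s)) => e e0.
pose A := (C : set (plane R)) `&` [set p | e <= enorm (p - touch C E s)].
have near_enough t : ~ A (touch C E t) -> `|touch C E s - touch C E t| < e.
  move=> nA; rewrite distrC (le_lt_trans (norm_le_enorm _))// ltNge.
  by apply/negP => h; apply: nA; split=> //; exact: touch_curve.
have [A0|A0] := pselect (A !=set0); last first.
  by near=> t; apply: near_enough => At; apply: A0; exists (touch C E t).
have cA : compact A.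
  apply: (subclosed_compact _ (curve_compact (C := C))); last by move=> x [].
  apply: closedI; first exact: convex_curve_closed.
  apply: (@closed_comp _ _ (Defs.edist ^~ (touch C E s)) [set r | e <= r]).
    by move=> x _; exact: edist_continuous.
  exact: closed_ge.
have [p [Cp pe] pm] :=
  compact_attains_max cA A0 (@dot_continuous R (normal E s)).
have [M M0 CM] := compact_enorm_bounded (curve_compact (C := C)).
pose g := dot (touch C E s) (normal E s) - dot p (normal E s).
have g0 : 0 < g.
  rewrite subr_gt0 ltNge; apply/negP => h.
  have pf : face C (normal E s) p.
    by split=> // x /(touch_face C E s).2/le_trans; apply.
  move: pe => /=; rewrite (touch_unique tC E1 pf) subrr enorm0.
  by rewrite leNgt e0.
have d0 : 0 < g / (2 * M) by rewrite divr_gt0// mulr_gt0.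
near=> t; apply: near_enough => At; have [Ct _] := At.
have st : `|t - s| < g / (2 * M).
  rewrite distrC; near: t; exact: cvgr_dist_lt d0.
have := (touch_face C E t).2 _ (touch_curve C E s).
have nt x : dot x (normal E t) = dot x (normal E s) + (t - s) * dot x (rot E).
  by rewrite -dotZr -dotDr -normalD; congr (dot _ (normal _ _)); ring.
rewrite !nt; have := pm _ At.
have nE : enorm (rot E) = 1 by rewrite enorm_rot /enorm E1 sqrtr1.
have : `|(t - s) * dot (touch C E t - touch C E s) (rot E)| < g.
  rewrite normrM (@le_lt_trans _ _ (`|t - s| * (2 * M)))//; last first.
    by rewrite -ltr_pdivlMr// mulr_gt0.
  rewrite ler_wpM2l// (le_trans (normr_dot_le _ _))// nE mulr1.
  rewrite (le_trans (enormD _ _))// enormN.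
  by have := CM _ Ct; have := CM _ (touch_curve C E s); lra.
rewrite ltr_norml dotBl => /andP[h1 h2] h3 h4.
by move: g0 h1 h2 h3 h4; rewrite /g; lra.
Unshelve. all: by end_near.
Qed.

End TangentLines.

(** * Reflection in a typical curve *)

Section Reflection.
Context {R : realType}.
Implicit Types (p q w x y z E u v : plane R).
Implicit Types (C : convex_curve R) (a b e r s t c : R).

(** Depth of [u] below the tangent line with normal [normal E s], and its
    position along this line relative to the point of contact; both are scaled
    by the length of the normal. *)
Definition depth C E u s := dot (touch C E s - u) (normal E s).
Definition shift C E u s := dot (u - touch C E s) (rot (normal E s)).

(** The ray from [v] is reflected to [u] when the slopes [shift / depth] of [u]
    and [v] as seen from the point of contact are opposite. *)
Definition mirror C E u v s :=
  shift C E u s * depth C E v s + shift C E v s * depth C E u s.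

Lemma rot_normal E s : rot (normal E s) = rot E - s *: E.
Proof. by rewrite /normal rotD rotZ rot_rot scalerN. Qed.

Lemma dot_cvg (f g : R -> plane R) :
  continuous f -> continuous g -> continuous (fun s => dot (f s) (g s)).
Proof.
move=> cf cg s.
have coordc (h : R -> plane R) i :
    continuous h -> continuous (fun s => h s ord0 i).
  move=> ch r; apply: (@continuous_comp _ _ _ h (fun A : plane R => A ord0 i)).
    exact: ch.
  exact: coord_continuous.
rewrite (_ : (fun s => dot (f s) (g s)) = fun s =>
    f s ord0 ord0 * g s ord0 ord0 + f s ord0 ord_max * g s ord0 ord_max).
  by apply: cvgD; apply: cvgM; exact: coordc.
by apply/funext => r; rewrite dot2E.
Qed.

Lemma affine_continuous p q : continuous (fun s => p + s *: q : plane R).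
Proof.
by move=> s; apply: cvgD; [exact: cvg_cst|apply: cvgZr_tmp; exact: cvg_id].
Qed.

Lemma depth_continuous C E u : typical C -> dot E E = 1 ->
  continuous (depth C E u).
Proof.
move=> tC E1; apply: dot_cvg; last exact: affine_continuous.
move=> s; apply: cvgB; [exact: touch_continuous|exact: cvg_cst].
Qed.

Lemma shift_continuous C E u : typical C -> dot E E = 1 ->
  continuous (shift C E u).
Proof.
move=> tC E1; apply: dot_cvg => s.
  by apply: cvgB; [exact: cvg_cst|exact: touch_continuous].
rewrite (_ : (fun _ => _) = fun s => rot E + s *: (- E)).
  exact: affine_continuous.
by apply/funext => r; rewrite rot_normal scalerN.
Qed.

Lemma mirror_continuous C E u v : typical C -> dot E E = 1 ->
  continuous (mirror C E u v).
Proof.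
move=> tC E1 s.
have cS w := @shift_continuous C E w tC E1 s.
have cD w := @depth_continuous C E w tC E1 s.
exact: (cvgD (cvgM (cS u) (cD v)) (cvgM (cS v) (cD u))).
Qed.

Lemma depthE C E u s : depth C E u s =
  dot (touch C E s - u) E + s * dot (touch C E s - u) (rot E).
Proof. by rewrite /depth /normal dotDr dotZr. Qed.

Lemma shiftE C E u s : shift C E u s =
  s * dot (touch C E s - u) E - dot (touch C E s - u) (rot E).
Proof. by rewrite /shift -opprB dotNl rot_normal dotBr dotZr; ring. Qed.

(** Each end of the chord is extreme for its own normal; read in the basis of
    the two tangent vectors, this says that the coordinates are nonnegative. *)
Lemma chordE C E s t : dot E E = 1 -> s < t -> exists a b, [/\ 0 <= a, 0 <= b &
  touch C E t - touch C E s = a *: rot (normal E s) + b *: rot (normal E t)].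
Proof.
move=> E1 st; have h0 : 0 < t - s by rewrite subr_gt0.
set d := _ - _.
exists (dot d (normal E t) / (t - s)), (- dot d (normal E s) / (t - s)); split.
- rewrite divr_ge0 ?(ltW h0)// /d dotBl subr_ge0.
  by apply: (touch_face C E t).2; exact: touch_curve.
- rewrite divr_ge0 ?(ltW h0)// oppr_ge0 /d dotBl subr_le0.
  by apply: (touch_face C E s).2; exact: touch_curve.
- clearbody d; apply: (@scalerI _ _ (t - s)); first by rewrite gt_eqF.
  rewrite [RHS]scalerDr !scalerA !(mulrC (t - s)) !mulfVK ?gt_eqF//.
  move: E1; rewrite /normal !dot2E => E1; apply: plane_eqP; rewrite !mxE /=.
  + by rewrite -[LHS]mulr1 -E1; ring.
  + by rewrite -[LHS]mulr1 -E1; ring.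
Qed.

Lemma depth_chord C E u s t a b : dot E E = 1 ->
  touch C E t - touch C E s = a *: rot (normal E s) + b *: rot (normal E t) ->
  depth C E u t = depth C E u s + (t - s) * (a + dot (touch C E s - u) (rot E)).
Proof.
move=> E1 d; have zt : touch C E t - u =
    (touch C E t - touch C E s) + (touch C E s - u).
  by rewrite subrKA.
rewrite /depth zt d; set y := touch C E s - u.
rewrite dotDl dotDl !dotZl dot_rotl mulr0 addr0 rot_normal /normal.
by rewrite !dotE dot_rot dot_rotr dot_rotl E1; ring.
Qed.

Lemma shift_chord C E u s t a b : dot E E = 1 ->
  touch C E t - touch C E s = a *: rot (normal E s) + b *: rot (normal E t) ->
  shift C E u t = shift C E u s - (a * (1 + s * t) + b * (1 + t * t))
    + (t - s) * dot (touch C E s - u) E.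
Proof.
move=> E1 d; have zt : u - touch C E t =
    - ((touch C E t - touch C E s) + (touch C E s - u)).
  by rewrite subrKA opprB.
rewrite /shift zt d -(opprB (touch C E s)); set y := touch C E s - u.
rewrite !dotNl dotDl dotDl !dotZl !dot_rot !dot_normal// !rot_normal.
by rewrite !dotE; ring.
Qed.

Lemma chord_length C E s t a b : dot E E = 1 ->
  touch C E t - touch C E s = a *: rot (normal E s) + b *: rot (normal E t) ->
  dot (touch C E t - touch C E s) (rot E) = a + b.
Proof.
move=> E1 ->; rewrite dotDl !dotZl !dot_rot /normal !dotDl !dotZl !dot_rotl E1.
ring.
Qed.

End Reflection.

(** The next two lemmas compare the values of the mirror functional at two
    normals of slopes [s < t], in terms of the depth [A], the shift [B] and the
    coordinates [W], [V] of the two points, and of the coefficients [a], [b] of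
    the chord. *)
Section MirrorEstimates.
Context {R : realType}.
Implicit Types (s t a b m M k w N Au Bu Wu Vu Av Bv Wv Vv : R).

Lemma normr_mul_le (x y X Y : R) : `|x| <= X -> `|y| <= Y -> `|x * y| <= X * Y.
Proof. by move=> xX yY; rewrite normrM ler_pM. Qed.

Lemma normr_add_le (x y X Y : R) : `|x| <= X -> `|y| <= Y -> `|x + y| <= X + Y.
Proof. by move=> xX yY; rewrite (le_trans (ler_normD _ _))// lerD. Qed.

(** On an almost flat arc the contact point moves much faster than the tangent
    line turns, and the mirror functional decreases. *)
Lemma mirror_decrease m M s t a b Au' Bu Wu Vu Av' Bv Wv Vv :
  0 < m -> s < t -> t - s <= 1 -> 0 <= a -> 0 <= b ->
  m <= Au' -> m <= Av' -> Au' <= M -> Av' <= M -> a <= M ->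
  `|Bu| <= M -> `|Bv| <= M -> `|Wu| <= M -> `|Wv| <= M ->
  `|Vu| <= M -> `|Vv| <= M ->
  (6 * M * M + 1) / m * (t - s) < a + b ->
  - (a * (1 + s * t) + b * (1 + t * t)) * (Au' + Av')
  + (t - s) * (Wu * Av' + Wv * Au' + Bu * (a + Vv) + Bv * (a + Vu)) < - (t - s).
Proof.
move=> m0 st h1 a0 b0 mu mv uM vM aM BuM BvM WuM WvM VuM VvM.
rewrite mulrAC ltr_pdivrMr//; set h := t - s => L.
have h0 : 0 < h by rewrite subr_gt0.
have D : (a + b) / 2 <= a * (1 + s * t) + b * (1 + t * t).
  have e1 : 1 / 2 <= 1 + s * t.
    have hh : h * h <= 1 by rewrite mulr_ile1// ltW.
    have -> : t = s + h by rewrite /h; ring.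
    by have := sqr_ge0 (s + h / 2); rewrite expr2; lra.
  have e2 : 1 / 2 <= 1 + t * t by have := sqr_ge0 t; rewrite expr2; lra.
  have := ler_wpM2l a0 e1; have := ler_wpM2l b0 e2; lra.
have M0 : 0 <= M by exact: le_trans (normr_ge0 _) BuM.
have na : `|a| <= M by rewrite ger0_norm.
have nA (x : R) : m <= x -> x <= M -> `|x| <= M.
  by move=> mx xM; rewrite ger0_norm// (le_trans (ltW m0)).
have K := normr_add_le (normr_add_le (normr_add_le
  (normr_mul_le WuM (nA _ mv vM)) (normr_mul_le WvM (nA _ mu uM)))
  (normr_mul_le BuM (normr_add_le na VvM))) (normr_mul_le BvM (normr_add_le na VuM)).
have {}K := le_trans (ler_norm _) K.
have hK := ler_wpM2l (ltW h0) K.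
have AA : 2 * m <= Au' + Av' by lra.
have ab : 0 <= (a + b) / 2 by rewrite divr_ge0// addr_ge0.
have P : (a + b) / 2 * (2 * m) <= (a * (1 + s * t) + b * (1 + t * t)) * (Au' + Av').
  by apply: ler_pM => //; lra.
rewrite mulNr; lra.
Qed.

(** Near a corner the tangent line turns much faster than the contact point
    moves, and the mirror functional increases when it is almost zero. *)
Lemma mirror_increase m M : 0 < m -> 1 <= M -> exists N w k,
  [/\ 0 <= N, 0 < w, 0 < k &
  forall s t a b Au Au' Bu Wu Vu Av Av' Bv Wv Vv,
  s < t -> t - s <= w -> 0 <= a -> 0 <= b ->
  m <= Au -> m <= Av -> `|Au'| <= M -> `|Av'| <= M -> `|s| <= M -> `|t| <= M ->
  `|Bu| <= M -> `|Bv| <= M -> `|Wu| <= M -> `|Wv| <= M ->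
  `|Vu| <= M -> `|Vv| <= M -> a <= M ->
  Au = Wu + s * Vu -> Av = Wv + s * Vv ->
  Bu = s * Wu - Vu -> Bv = s * Wv - Vv ->
  Au' = Au + (t - s) * (a + Vu) -> Av' = Av + (t - s) * (a + Vv) ->
  `|Bu * Av + Bv * Au| <= w -> N * (a + b) < t - s ->
  k * (t - s) <= - (a * (1 + s * t) + b * (1 + t * t)) * (Au' + Av')
  + (t - s) * (Wu * Av' + Wv * Au' + Bu * (a + Vv) + Bv * (a + Vu))].
Proof.
move=> m0 M1; have M0 : 0 < M by rewrite (lt_le_trans _ M1).
pose X := 1 + M * M; have X0 : 0 < X by rewrite /X ltr_wpDr ?mulr_ge0// ltW.
pose k := m * m / (4 * X).
have k0 : 0 < k by rewrite divr_gt0 ?mulr_gt0.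
pose N := Num.max 1 (2 * M * X / k).
have N1 : 1 <= N by rewrite le_max lexx.
have Nk : 2 * M * X <= N * k by rewrite -ler_pdivrMr// le_max lexx orbT.
have mm0 : 0 < m * m by rewrite mulr_gt0.
pose w := Num.min (m * m / 2 / (M / m + M)) (2 * k / (6 * M * M + 2 * M)).
have w1 : w * (M / m + M) <= m * m / 2.
  by rewrite -ler_pdivlMr ?ge_min ?lexx// addr_gt0// divr_gt0.
have w2 : w * (6 * M * M + 2 * M) <= 2 * k.
  by rewrite -ler_pdivlMr ?ge_min ?lexx ?orbT// addr_gt0// !mulr_gt0.
have w0 : 0 < w.
  have S0 : 0 < M / m + M by rewrite addr_gt0// divr_gt0.
  have T0 : 0 < 6 * M * M + 2 * M by rewrite addr_gt0// !mulr_gt0.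
  have mm2 : 0 < m * m / 2 by rewrite divr_gt0.
  have k2 : 0 < 2 * k by rewrite mulr_gt0.
  by rewrite lt_min (divr_gt0 mm2 S0) (divr_gt0 k2 T0).
exists N, w, k; split=> //; first exact: le_trans N1.
move=> s t a b Au Au' Bu Wu Vu Av Av' Bv Wv Vv st hw a0 b0 mu mv uM vM sM tM.
move=> BuM BvM WuM WvM VuM VvM aM AuE AvE BuE BvE Au'E Av'E.
set h := t - s in hw Au'E Av'E *; set Psi := Bu * Av + Bv * Au => Pw NL.
have h0 : 0 < h by rewrite subr_gt0.
have na : `|a| <= M by rewrite ger0_norm.
have L0 : 0 <= a + b by rewrite addr_ge0.
have Lh : a + b <= h by rewrite (le_trans _ (ltW NL))// ler_peMl.
have ah : a <= h by lra.
(* [Q] is the rate of change due to the rotation of the tangent line alone, at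
   [s]; it is bounded below because the shifts have opposite signs when the
   mirror functional vanishes. *)
pose Q := Wu * Av + Wv * Au + Bu * Vv + Bv * Vu.
pose Rm := Wu * (h * (a + Vv)) + Wv * (h * (a + Vu)) + a * (Bu + Bv).
have -> : Wu * Av' + Wv * Au' + Bu * (a + Vv) + Bv * (a + Vu) = Q + Rm.
  by rewrite Au'E Av'E /Q /Rm; ring.
have QE : (1 + s * s) * Q = 2 * (Au * Av - Bu * Bv) + 2 * (s * Psi).
  by rewrite /Q /Psi AuE AvE BuE BvE; ring.
have BB : Bu * Bv <= w * (M / m).
  have Av0 : 0 < Av by exact: lt_le_trans mv.
  rewrite -(ler_pM2r Av0).
  have e1 : Bu * Bv * Av <= Psi * Bv.
    have -> : Bu * Bv * Av = Psi * Bv - Bv * Bv * Au by rewrite /Psi; ring.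
    rewrite lerBlDr lerDl mulr_ge0 ?(le_trans (ltW m0) mu)//.
    by rewrite -expr2 sqr_ge0.
  have e2 : Psi * Bv <= w * M by exact: le_trans (ler_norm _) (normr_mul_le Pw BvM).
  have e3 : w * M <= w * (M / m) * Av.
    rewrite -mulrA ler_pM2l// mulrAC ler_pdivlMr// ler_pM2l//.
  lra.
have sP : - (w * M) <= s * Psi.
  by have := normr_mul_le sM Pw; rewrite ler_norml mulrC => /andP[].
have AA : m * m <= Au * Av by apply: ler_pM => //; exact: ltW.
have Q4 : 4 * k <= Q.
  have s1 : 1 + s * s <= X.
    by rewrite lerD2l (le_trans (ler_norm _))//; exact: normr_mul_le.
  have s0 : 0 < 1 + s * s by rewrite ltr_pwDl// -expr2 sqr_ge0.
  have sQ : m * m <= (1 + s * s) * Q by rewrite QE; lra.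
  have Q0 : 0 <= Q by rewrite -(pmulr_rge0 _ s0) (le_trans (ltW mm0)).
  have : m * m <= X * Q by apply: le_trans sQ _; rewrite ler_wpM2r.
  have -> : 4 * k = m * m / X by rewrite /k; field; rewrite gt_eqF.
  by rewrite ler_pdivrMr// (mulrC Q).
have RmK : - (2 * k) <= Rm.
  have nh : `|h| <= w by rewrite gtr0_norm.
  have naw : `|a| <= w by rewrite ger0_norm// (le_trans ah).
  have := normr_add_le (normr_add_le
    (normr_mul_le WuM (normr_mul_le nh (normr_add_le na VvM)))
    (normr_mul_le WvM (normr_mul_le nh (normr_add_le na VuM))))
    (normr_mul_le naw (normr_add_le BuM BvM)).
  rewrite -/Rm ler_norml => /andP[+ _].
  have : 0 <= w * (M * M) by rewrite !mulr_ge0// ltW.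
  lra.
have DX : (a * (1 + s * t) + b * (1 + t * t)) * (Au' + Av') <= k * h.
  have e1 : `|a * (1 + s * t) + b * (1 + t * t)| <= a * X + b * X.
    have n1 : `|1 : R| <= 1 by rewrite normr1.
    have nb : `|b| <= b by rewrite ger0_norm.
    have na' : `|a| <= a by rewrite ger0_norm.
    exact: (normr_add_le
      (normr_mul_le na' (normr_add_le n1 (normr_mul_le sM tM)))
      (normr_mul_le nb (normr_add_le n1 (normr_mul_le tM tM)))).
  have e2 := normr_mul_le e1 (normr_add_le uM vM).
  apply: le_trans (ler_norm _) _; apply: le_trans e2 _.
  have e3 : (a + b) * (2 * M * X) <= (a + b) * (N * k) by rewrite ler_wpM2l.
  have e4 : N * (a + b) * k <= h * k by rewrite ler_wpM2r ?ltW.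
  lra.
have : h * (2 * k) <= h * (Q + Rm) by rewrite ler_wpM2l ?(ltW h0)//; lra.
rewrite mulNr; lra.
Qed.

End MirrorEstimates.

Section Oscillation.
Context {R : realType}.
Implicit Types (p q w x y z E u v : plane R).
Implicit Types (C : convex_curve R) (a b e r s t c d m M k : R).

Lemma near_gt (f : R -> R) c m : continuous f -> m < f c ->
  exists2 d, 0 < d & forall s, `|s - c| < d -> m < f s.
Proof.
move=> cf mc.
have : \forall s \near c, m < f s by exact: (cvgr_gt (f c)) (cf c) _ mc.
move=> /nbhs_ballP[d /= d0 h]; exists d => // s sc; apply: h.
by rewrite /ball /= distrC.
Qed.

(** Moving [u] along the tangent direction at [s] changes the mirror functional
    at [s] at a rate given by the depth of [v], so every small value is
    attained close to a point where it vanishes. *)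
Lemma mirror_steer C E u v c e : typical C -> dot E E = 1 ->
  0 < depth C E v c -> mirror C E u v c = 0 -> 0 < e ->
  exists2 d, 0 < d & forall s r, `|s - c| < d -> `|r| < d ->
    exists2 u', enorm (u' - u) < e & mirror C E u' v s = r.
Proof.
move=> tC E1 vc mc e0; pose m := depth C E v c / 2.
have m0 : 0 < m by rewrite divr_gt0.
have mv : m < depth C E v c by rewrite /m; lra.
have em0 : 0 < e * m / 2 by rewrite divr_gt0// mulr_gt0.
have [d1 d10 h1] := near_gt (depth_continuous (u := v) tC E1) mv.
have cM : continuous (fun s => - `|mirror C E u v s|).
  move=> s; apply: cvgN; apply: cvg_norm; exact: mirror_continuous.
have [|d2 d20 h2] := @near_gt _ c (- (e * m / 2)) cM.
  by rewrite mc normr0 oppr0; lra.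
exists (Num.min (e * m / 2) (Num.min d1 d2)).
  by rewrite !lt_min em0 d10 d20.
move=> s r; rewrite !lt_min => /and3P[_ /h1 vs /h2 us] /andP[re _].
rewrite ltrN2 in us.
have s1 : 1 <= 1 + s * s by rewrite lerDl -expr2 sqr_ge0.
have s0 : 0 < 1 + s * s by exact: lt_le_trans s1.
have v0 : 0 < depth C E v s by exact: lt_trans vs.
pose k := (r - mirror C E u v s) / ((1 + s * s) * depth C E v s).
exists (u + k *: rot (normal E s)).
  rewrite addrAC subrr add0r enormZ enorm_rot.
  have ns : enorm (normal E s) <= 1 + s * s.
    rewrite -(@ler_pXn2r _ 2)// ?nnegrE ?enorm_ge0 ?(ltW s0)//.
    by rewrite sqr_enorm dot_normal// ler_eXnr// ltW.
  apply: le_lt_trans (ler_wpM2l (normr_ge0 k) ns) _.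
  have -> : `|k| * (1 + s * s) = `|r - mirror C E u v s| / depth C E v s.
    rewrite /k normrM normfV (gtr0_norm (mulr_gt0 s0 v0)); field.
    by rewrite !gt_eqF.
  rewrite ltr_pdivrMr//.
  have := ler_normB r (mirror C E u v s).
  have : e * m < e * depth C E v s by rewrite ltr_pM2l.
  lra.
have zu : shift C E (u + k *: rot (normal E s)) s =
    shift C E u s + k * (1 + s * s).
  by rewrite /shift !dotBl dotDl dotZl dot_rot dot_normal//; ring.
have du : depth C E (u + k *: rot (normal E s)) s = depth C E u s.
  by rewrite /depth !dotBl dotDl dotZl dot_rotl mulr0 addr0.
rewrite /mirror zu du mulrDl addrAC -/(mirror C E u v s) /k.
by field; rewrite !gt_eqF.
Qed.

(** The increment in the form that the estimates above bound. *)
Lemma mirror_chord C E u v s t a b : dot E E = 1 ->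
  touch C E t - touch C E s = a *: rot (normal E s) + b *: rot (normal E t) ->
  mirror C E u v t = mirror C E u v s +
  (- (a * (1 + s * t) + b * (1 + t * t)) * (depth C E u t + depth C E v t)
  + (t - s) * (dot (touch C E s - u) E * depth C E v t
             + dot (touch C E s - v) E * depth C E u t
             + shift C E u s * (a + dot (touch C E s - v) (rot E))
             + shift C E v s * (a + dot (touch C E s - u) (rot E)))).
Proof.
move=> E1 d; rewrite /mirror !(shift_chord _ E1 d).
by rewrite !(depth_chord _ E1 d); ring.
Qed.

(** Uniform constants for those estimates near [u] and [c]. *)
Lemma mirror_bounds C E u v c : typical C -> dot E E = 1 ->
  0 < depth C E u c -> 0 < depth C E v c ->
  exists m M d, [/\ 0 < m, 1 <= M, 0 < d &
  forall u' s, enorm (u' - u) < d -> `|s - c| < d ->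
  [/\ `|s| <= M /\ (forall t, dot (touch C E t - touch C E s) (rot E) <= M),
      (m <= depth C E u' s <= M) && (m <= depth C E v s <= M),
      `|shift C E u' s| <= M /\ `|shift C E v s| <= M,
      `|dot (touch C E s - u') E| <= M /\ `|dot (touch C E s - v) E| <= M &
      `|dot (touch C E s - u') (rot E)| <= M /\
      `|dot (touch C E s - v) (rot E)| <= M]].
Proof.
move=> tC E1 uc vc.
have [N N0 CN] := compact_enorm_bounded (curve_compact (C := C)).
pose m0 := Num.min (depth C E u c) (depth C E v c) / 2.
have min0 : 0 < Num.min (depth C E u c) (depth C E v c) by rewrite lt_min uc.
have m00 : 0 < m0 by rewrite divr_gt0.
have mu : m0 < depth C E u c.
  have : Num.min (depth C E u c) (depth C E v c) <= depth C E u c.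
    by rewrite ge_min lexx.
  rewrite /m0; lra.
have mv : m0 < depth C E v c.
  have : Num.min (depth C E u c) (depth C E v c) <= depth C E v c.
    by rewrite ge_min lexx orbT.
  rewrite /m0; lra.
have [d1 d10 h1] := near_gt (depth_continuous (u := u) tC E1) mu.
have [d2 d20 h2] := near_gt (depth_continuous (u := v) tC E1) mv.
pose S := `|c| + 1; pose B := N + enorm u + enorm v + 1.
have S1 : 1 <= S by rewrite /S lerDr.
have S0 : 0 < S by exact: lt_le_trans S1.
have nu := enorm_ge0 u; have nv := enorm_ge0 v.
have B1 : 1 <= B by rewrite /B; lra.
have B0 : 0 < B by exact: lt_le_trans B1.
have BS : 0 < B * S by rewrite mulr_gt0.
pose M := 2 * B + B * S + S.
exists (m0 / 2), M, (Num.min 1 (Num.min (m0 / 2 / (1 + S)) (Num.min d1 d2))).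
split.
- by rewrite divr_gt0.
- by rewrite /M; lra.
- by rewrite !lt_min d10 d20 ltr01 !divr_gt0// addr_gt0.
move=> u' s; rewrite !lt_min => /and4P[u1 um _ _] /and4P[s1 _ /h1 us /h2 vs].
have nE : enorm E = 1 by rewrite /enorm E1 sqrtr1.
have nrE : enorm (rot E) = 1 by rewrite enorm_rot.
have sS : `|s| <= S.
  by rewrite -(subrK c s) (le_trans (ler_normD _ _))// /S addrC lerD2l ltW.
have zN := CN _ (touch_curve C E s).
have u'B : enorm u' <= enorm u + 1.
  by rewrite -(subrK u u') (le_trans (enormD _ _))// addrC lerD2l ltW.
have dB (w e : plane R) : enorm e = 1 -> enorm w <= enorm u + enorm v + 1 ->
    `|dot (touch C E s - w) e| <= B.
  move=> ne nw; rewrite (le_trans (normr_dot_le _ _))// ne mulr1.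
  by rewrite (le_trans (enormD _ _))// enormN /B -2!addrA lerD// addrA.
have Wu : `|dot (touch C E s - u') E| <= B by apply: dB => //; lra.
have Wv : `|dot (touch C E s - v) E| <= B by apply: dB => //; lra.
have Vu : `|dot (touch C E s - u') (rot E)| <= B by apply: dB => //; lra.
have Vv : `|dot (touch C E s - v) (rot E)| <= B by apply: dB => //; lra.
have BM : B + S * B <= M by rewrite /M; lra.
have dM w : `|dot (touch C E s - w) E| <= B ->
    `|dot (touch C E s - w) (rot E)| <= B -> depth C E w s <= M.
  move=> hW hV; rewrite depthE (le_trans (ler_norm _))//.
  by rewrite (le_trans (normr_add_le hW (normr_mul_le sS hV))).
have sM w : `|dot (touch C E s - w) E| <= B ->
    `|dot (touch C E s - w) (rot E)| <= B -> `|shift C E w s| <= M.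
  move=> hW hV; rewrite shiftE (le_trans (ler_normB _ _))//.
  by have := normr_mul_le sS hW; lra.
have du' : m0 / 2 <= depth C E u' s.
  have -> : depth C E u' s = depth C E u s - dot (u' - u) (normal E s).
    by rewrite /depth !dotBl; ring.
  have ns : enorm (normal E s) <= 1 + S.
    by rewrite (le_trans (enormD _ _))// enormZ nE nrE mulr1 lerD2l.
  have := le_trans (dot_le_enorm (u' - u) (normal E s))
    (ler_wpM2l (enorm_ge0 _) ns).
  have S10 : 0 < 1 + S by rewrite addr_gt0.
  by rewrite ltr_pdivlMr// in um; lra.
split.
- split; first by rewrite /M; lra.
  move=> t; rewrite (le_trans (dot_le_enorm _ _))// nrE mulr1.
  rewrite (le_trans (enormD _ _))// enormN.
  by have := CN _ (touch_curve C E t); rewrite /M /B in BS *; lra.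
- by rewrite du' !dM//= andbT; lra.
- by split; exact: sM.
- by split; rewrite /M; lra.
- by split; rewrite /M; lra.
Qed.

(** Near a point of reflection both sign patterns can be produced by moving
    [u] slightly: one on an almost flat arc, the other on an almost cornered
    one. *)
Lemma typical_falling C (k : nat) u v c e : typical C ->
  0 < depth C (axis k) u c -> 0 < depth C (axis k) v c ->
  mirror C (axis k) u v c = 0 -> 0 < e ->
  exists u' s t, [/\ enorm (u' - u) < e, c - e < s, s < t, t < c + e &
    mirror C (axis k) u' v t < 0 < mirror C (axis k) u' v s].
Proof.
set E := axis k => tC uc vc mc e0; have E1 : dot E E = 1 by exact: axis_unit.
have [stretch _ _] := tC.
have [m [M [d [m0 M1 d0 bnd]]]] := mirror_bounds tC E1 uc vc.
have M0 : 0 <= M by exact: le_trans M1.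
pose e1 := Num.min e d; have e10 : 0 < e1 by rewrite lt_min e0.
have [g g0 steer] := mirror_steer tC E1 vc mc e10.
pose f := Num.min (1 / 2) (Num.min e1 g).
have f0 : 0 < f by do 2 rewrite lt_min; rewrite e10 g0 divr_gt0.
have f1 : f <= 1 / 2 by rewrite ge_min lexx.
have fe1 : f <= e1 by do 2 rewrite ge_min; rewrite lexx /= orbT.
have fg : f <= g by do 2 rewrite ge_min; rewrite lexx !orbT.
have e1e : e1 <= e by rewrite ge_min lexx.
have e1d : e1 <= d by rewrite ge_min lexx orbT.
have [||s [t [p [q [[cs st tc] pf qf L]]]]] :=
  stretch k ((6 * M * M + 1) / m) (c - f) (c + f).
- by rewrite divr_ge0 ?(ltW m0)// addr_ge0// !mulr_ge0.
- lra.
have [sc tc'] : `|s - c| < f /\ `|t - c| < f by rewrite !ltr_norml; lra.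
(* The functional drops by more than [t - s] from [s] to [t]: start it at half
   of this at [s]. *)
have [|u' u'u u's] := steer s ((t - s) / 2) (lt_le_trans sc fg).
  by rewrite gtr0_norm; lra.
exists u', s, t; split.
- exact: lt_le_trans e1e.
- lra.
- by [].
- lra.
rewrite u's; apply/andP; split; last by rewrite divr_gt0// subr_gt0.
have u'd : enorm (u' - u) < d by exact: lt_le_trans e1d.
have [[_ aM] _ [Bu Bv] [Wu Wv] [Vu Vv]] :=
  bnd u' s u'd (lt_le_trans sc (le_trans fe1 e1d)).
have [_ /andP[/andP[mu uM] /andP[mv vM]] _ _ _] :=
  bnd u' t u'd (lt_le_trans tc' (le_trans fe1 e1d)).
have [a [b [a0 b0 ab]]] := chordE C E1 st.
have Lab := chord_length E1 ab.
rewrite (touch_unique tC E1 pf) (touch_unique tC E1 qf) Lab in L.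
have aM' : a <= M by have := aM t; rewrite Lab; lra.
rewrite (mirror_chord _ _ E1 ab) u's.
have ts1 : t - s <= 1 by lra.
have := mirror_decrease m0 st ts1 a0 b0 mu mv uM vM aM' Bu Bv Wu Wv Vu Vv L.
lra.
Qed.

Lemma typical_rising C (k : nat) u v c e : typical C ->
  0 < depth C (axis k) u c -> 0 < depth C (axis k) v c ->
  mirror C (axis k) u v c = 0 -> 0 < e ->
  exists u' s t, [/\ enorm (u' - u) < e, c - e < s, s < t, t < c + e &
    mirror C (axis k) u' v s < 0 < mirror C (axis k) u' v t].
Proof.
set E := axis k => tC uc vc mc e0; have E1 : dot E E = 1 by exact: axis_unit.
have [_ squeeze _] := tC.
have [m [M [d [m0 M1 d0 bnd]]]] := mirror_bounds tC E1 uc vc.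
have [N [w [l [N0 w0 l0 increase]]]] := mirror_increase m0 M1.
pose e1 := Num.min e d; have e10 : 0 < e1 by rewrite lt_min e0.
have [g g0 steer] := mirror_steer tC E1 vc mc e10.
pose f := Num.min (w / 2) (Num.min (w / l) (Num.min e1 (g / l))).
have f0 : 0 < f by do 3 rewrite lt_min; rewrite e10 !divr_gt0.
pose f' := Num.min f g.
have f'0 : 0 < f' by rewrite lt_min f0.
have f'f : f' <= f by rewrite ge_min lexx.
have f'g : f' <= g by rewrite ge_min lexx orbT.
have fw : f <= w / 2 by rewrite ge_min lexx.
have fwl : f * l <= w.
  by rewrite -ler_pdivlMr//; do 2 rewrite ge_min; rewrite lexx /= orbT.
have fe1 : f <= e1 by do 3 rewrite ge_min; rewrite lexx /= !orbT.
have fgl : f * l <= g.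
  by rewrite -ler_pdivlMr//; do 3 rewrite ge_min; rewrite lexx !orbT.
have e1e : e1 <= e by rewrite ge_min lexx.
have e1d : e1 <= d by rewrite ge_min lexx orbT.
have [|s [t [p [q [[cs st tc] pf qf L]]]]] :=
  squeeze k N (c - f') (c + f') N0; first by lra.
have h0 : 0 < t - s by rewrite subr_gt0.
have [sc tc'] : `|s - c| < f' /\ `|t - c| < f' by rewrite !ltr_norml; lra.
have hl : (t - s) * l < 2 * (f * l).
  by rewrite mulrA ltr_pM2r//; lra.
have hl0 : 0 < l * (t - s) / 2 by rewrite divr_gt0// mulr_gt0.
(* Now it rises by [l * (t - s)] at least. *)
have [|u' u'u u's] := steer s (- (l * (t - s) / 2)) (lt_le_trans sc f'g).
  by rewrite normrN gtr0_norm//; lra.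
exists u', s, t; split.
- exact: lt_le_trans e1e.
- lra.
- by [].
- lra.
rewrite u's oppr_lt0 hl0 /=.
have u'd : enorm (u' - u) < d by exact: lt_le_trans e1d.
have fd : f' <= d by lra.
have [[sM aM] /andP[/andP[mu _] /andP[mv _]] [Bu Bv] [Wu Wv] [Vu Vv]] :=
  bnd u' s u'd (lt_le_trans sc fd).
have [[tM _] /andP[/andP[mu' uM] /andP[mv' vM]] _ _ _] :=
  bnd u' t u'd (lt_le_trans tc' fd).
have [a [b [a0 b0 ab]]] := chordE C E1 st.
have Lab := chord_length E1 ab.
rewrite (touch_unique tC E1 pf) (touch_unique tC E1 qf) Lab in L.
have aM' : a <= M by have := aM t; rewrite Lab; lra.
have nuM : `|depth C E u' t| <= M by rewrite ger0_norm// (le_trans (ltW m0)).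
have nvM : `|depth C E v t| <= M by rewrite ger0_norm// (le_trans (ltW m0)).
have tsw : t - s <= w by lra.
have Pw :
    `|shift C E u' s * depth C E v s + shift C E v s * depth C E u' s| <= w.
  by rewrite -/(mirror C E u' v s) u's normrN gtr0_norm//; lra.
have := increase s t a b _ _ _ _ _ _ _ _ _ _ st tsw a0 b0 mu mv nuM nvM sM tM
  Bu Bv Wu Wv Vu Vv aM' (depthE C E u' s) (depthE C E v s)
  (shiftE C E u' s) (shiftE C E v s) (depth_chord u' E1 ab)
  (depth_chord v E1 ab) Pw L.
rewrite (mirror_chord _ _ E1 ab) u's; lra.
Qed.

End Oscillation.

Section Images.
Context {R : realType}.
Implicit Types (p q w x y z E u v : plane R).
Implicit Types (C : convex_curve R) (a b e r s t c : R).

Lemma acos_double c : 0 <= c -> c <= 1 -> acos (2 * c ^+ 2 - 1) = 2 * acos c.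
Proof.
move=> c0 c1; have c11 : -1 <= c <= 1 by rewrite c1 andbT; lra.
have cE : cos (acos c) = c by apply: acosK; rewrite in_itv.
have h : acos c <= pi / 2.
  rewrite leNgt; apply/negP => h.
  have ac : acos c \in `[0, pi] by rewrite in_itv /= acos_ge0// acos_lepi.
  have pc : (pi / 2 : R) \in `[0, pi].
    by rewrite in_itv /=; have := pi_ge0 R; move=> ?; apply/andP; split; lra.
  have : cos (acos c) < cos (pi / 2 : R) by rewrite ltr_cos.
  by rewrite cE cos_pihalf ltNge c0.
have -> : 2 * c ^+ 2 - 1 = cos (2 * acos c).
  by rewrite !mulr_natl cos_mulr2n cE.
apply: cosK; rewrite in_itv/=; apply/andP; split; last lra.
by rewrite mulr_ge0// acos_ge0.
Qed.

(** The ray of the normal that cuts the angle is [- w]: both rays make with it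
    an angle of cosine [c], and they lie on different sides of it. *)
Lemma halves_angle_normal w u v z : w != 0 ->
  0 < dot (z - u) w -> 0 < dot (z - v) w ->
  dot (u - z) (rot w) * dot (z - v) w + dot (v - z) (rot w) * dot (z - u) w = 0 ->
  halves_angle (normal_line (line w (dot w z)) z) u z v.
Proof.
move=> w0 uw vw uv.
have uz : u - z != 0.
  by apply/eqP => h; move: uw; rewrite -opprB h oppr0 dot0l ltxx.
have vz : v - z != 0.
  by apply/eqP => h; move: vw; rewrite -opprB h oppr0 dot0l ltxx.
have nw := enorm_gt0 w0; have nu := enorm_gt0 uz; have nv := enorm_gt0 vz.
split; [by rewrite -subr_eq0|by rewrite -subr_eq0|].
exists (z - w).
have zw : z - w - z = - w by rewrite addrAC subrr add0r.
pose A := dot (z - u) w; pose A' := dot (z - v) w.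
pose B := dot (u - z) (rot w); pose B' := dot (v - z) (rot w).
have uE : dot (u - z) w = - A by rewrite /A -(opprB u) dotNl opprK.
have vE : dot (v - z) w = - A' by rewrite /A' -(opprB v) dotNl opprK.
have nuE : (enorm (u - z) * enorm w) ^+ 2 = A ^+ 2 + B ^+ 2.
  by rewrite exprMn !sqr_enorm -lagrange_identity uE sqrrN.
have nvE : (enorm (v - z) * enorm w) ^+ 2 = A' ^+ 2 + B' ^+ 2.
  by rewrite exprMn !sqr_enorm -lagrange_identity vE sqrrN.
pose c := A / (enorm (u - z) * enorm w).
have nuw : 0 < enorm (u - z) * enorm w by rewrite mulr_gt0.
have nvw : 0 < enorm (v - z) * enorm w by rewrite mulr_gt0.
have c0 : 0 <= c by rewrite divr_ge0 ?ltW.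
have c1 : c <= 1.
  rewrite ler_pdivrMr// mul1r -(@ler_pXn2r _ 2)// ?nnegrE ?(ltW uw) ?(ltW nuw)//.
  by rewrite nuE lerDl sqr_ge0.
have {}uv : B * A' + B' * A = 0 by exact: uv.
have AV : A' * (enorm (u - z) * enorm w) = A * (enorm (v - z) * enorm w).
  apply/eqP; rewrite -(@eqrXn2 _ 2)// ?mulr_ge0 ?enorm_ge0 ?(ltW uw) ?(ltW vw)//.
  rewrite !(exprMn _ A) !(exprMn _ A') nuE nvE; apply/eqP.
  have : (B * A') ^+ 2 = (B' * A) ^+ 2 by rewrite (_ : B * A' = - (B' * A)) ?sqrrN//; lra.
  by rewrite !exprMn; lra.
have BV : B' * (enorm (u - z) * enorm w) = - (B * (enorm (v - z) * enorm w)).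
  apply: (@mulfI _ A); first by rewrite gt_eqF.
  have BA : B' * A = - (B * A') by lra.
  transitivity (B' * A * (enorm (u - z) * enorm w)); first by ring.
  rewrite BA; transitivity (- (B * (A' * (enorm (u - z) * enorm w)))); first by ring.
  by rewrite AV; ring.
have cE : A' / (enorm (v - z) * enorm w) = c.
  by apply/eqP; rewrite /c eqr_div ?(lt0r_neq0 nuw) ?(lt0r_neq0 nvw)// AV.
have cosE : dot (u - z) (v - z) / (enorm (u - z) * enorm (v - z)) = 2 * c ^+ 2 - 1.
  have dE : dot (u - z) (v - z) * enorm w ^+ 2 = A * A' + B * B'.
    have frame x y : dot x y * dot w w =
        dot x w * dot y w + dot x (rot w) * dot y (rot w).
      by rewrite !dot2E !mxE /=; ring.
    by rewrite sqr_enorm frame uE vE mulrNN.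
  have U0 : enorm (u - z) != 0 by rewrite gt_eqF.
  have V0 : enorm (v - z) != 0 by rewrite gt_eqF.
  have W0 : enorm w != 0 by rewrite gt_eqF.
  apply: (@mulIf _ ((enorm (u - z) * enorm w) ^+ 2 * (enorm (v - z) * enorm w))).
    by rewrite !mulf_neq0// expf_neq0// mulf_neq0.
  transitivity (dot (u - z) (v - z) * enorm w ^+ 2 * (enorm (u - z) * enorm w)).
    by field; rewrite U0 V0.
  rewrite dE mulrDl -(mulrA A) AV -(mulrA B) BV /c.
  rewrite (_ : (2 * _ - 1) * _ = (2 * A ^+ 2 - (enorm (u - z) * enorm w) ^+ 2) *
    (enorm (v - z) * enorm w)); last by field; rewrite U0 W0.
  by rewrite nuE; ring.
have angE : angle u z v / 2 = acos c.
  by rewrite /angle cosE acos_double// mulrC mulKf.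
split.
- move=> q; rewrite /line /= => qT.
  by rewrite zw dotNl dotC dotBl !(dotC _ w) qT subrr oppr0.
- by rewrite -subr_eq0 zw oppr_eq0.
- by rewrite angE /angle zw dotNr uE opprK enormN.
- by rewrite angE /angle zw dotNl dotC vE opprK enormN mulrC -cE mulrC (mulrC (enorm w)).
Qed.


Lemma mirror_sees C E u v s : dot E E = 1 ->
  0 < depth C E u s -> 0 < depth C E v s -> mirror C E u v s = 0 ->
  sees_image C u v (touch C E s).
Proof.
move=> E1 us vs uvs; set z := touch C E s; set w := normal E s.
have w0 : w != 0 by exact: normal_neq0.
have Cw : (C : set (plane R)) `<=` half_plane w (dot w z).
  by apply/(sub_half_plane _ (touch_curve C E s)); exact: touch_face.
exists (line w (dot w z)); split.
- by apply/supporting_lineP; exists w.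
- exists w, (dot w z); split=> // x [/Cw//|[]->]; rewrite /half_plane /=.
  + by move: us; rewrite /depth dotC dotBr -/z -/w subr_gt0 => /ltW.
  + by move: vs; rewrite /depth dotC dotBr -/z -/w subr_gt0 => /ltW.
- exact: halves_angle_normal.
Qed.

(** The largest ellipse with foci [u] and [v] that meets the curve contains the
    curve, so it is tangent to it from outside; the reflection property of the
    ellipse gives the mirror equation, and the foci lie inside. *)
Lemma ellipse_contact C u v : exists w z, [/\ w != 0, face C w z,
  0 < dot (z - u) w, 0 < dot (z - v) w &
  dot (u - z) (rot w) * dot (z - v) w + dot (v - z) (rot w) * dot (z - u) w = 0].
Proof.
have [K [cK vK [i0 Ki0] CK Cf]] := curve_body C.
pose f (p : plane R) := Defs.edist p u + Defs.edist p v.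
have cf : continuous f.
  apply: (@enorm_lipschitz_continuous _ _ 2) => p q.
  rewrite /f opprD addrACA (le_trans (ler_normD _ _))//.
  by have := normr_edist_le u p q; have := normr_edist_le v p q; lra.
have [|z Kz zm] := compact_attains_max cK _ cf.
  by exists i0; exact: interior_subset.
(* The body has points off the segment from [u] to [v]. *)
have fz : enorm (u - v) < f z.
  have [p Kp pf] : exists2 p, K p & enorm (u - v) < f p.
    have [h h0 hK] := (nbhs_enormP _ _).1 Ki0.
    have far p : dot (p - u) (rot (v - u)) != 0 -> enorm (u - v) < f p.
      move=> pu; rewrite /f /Defs.edist (enormB p v).
      rewrite -(@ltr_pXn2r _ 2)// ?nnegrE ?addr_ge0 ?enorm_ge0//.
      rewrite sqrrD !sqr_enorm.
      have -> : dot (u - v) (u - v) = dot (p - u) (p - u) + 2 * dot (p - u) (v - p)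
          + dot (v - p) (v - p) by rewrite !dot2E !mxE; ring.
      have puE : dot (p - u) (rot (v - u)) = dot (p - u) (rot (v - p)).
        by rewrite !dot2E !mxE /=; ring.
      have : dot (p - u) (v - p) < enorm (p - u) * enorm (v - p).
        rewrite (le_lt_trans (ler_norm _))//.
        rewrite -(@ltr_pXn2r _ 2)// ?nnegrE ?mulr_ge0 ?enorm_ge0//.
        rewrite exprMn !sqr_enorm real_normK ?num_real// -lagrange_identity.
        by rewrite ltrDl lt_neqAle sqr_ge0 eq_sym expf_neq0// -puE.
      by lra.
    have [uv|uv] := eqVneq v u.
      have farp p : p != u -> enorm (u - v) < f p.
        rewrite /f /Defs.edist uv subrr enorm0 -subr_eq0 => pu.
        by rewrite addr_gt0// enorm_gt0.
      have [iu|iu] := eqVneq i0 u; last first.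
        by exists i0; [exact: interior_subset|exact: farp].
      have [|d d0 Kd] := @interior_step _ K i0 (vec2 1 0); first exact: Ki0.
      exists (i0 + d *: vec2 1 0) => //; apply: farp; rewrite iu.
      apply/eqP => /(congr1 (fun q : plane R => q ord0 ord0)).
      by rewrite !mxE /=; lra.
    have vu : rot (v - u) != 0 by rewrite rot_neq0// subr_eq0.
    have [iu|iu] := eqVneq (dot (i0 - u) (rot (v - u))) 0; last first.
      by exists i0; [exact: interior_subset|exact: far].
    have [d d0 Kd] := @interior_step _ K i0 (rot (v - u)) Ki0.
    exists (i0 + d *: rot (v - u)) => //; apply: far.
    rewrite addrAC dotDl iu add0r dotZl mulf_neq0 ?gt_eqF//.
    exact: dot_gt0.
  exact: lt_le_trans (zm _ Kp).
have fzE : f z = enorm (z - u) + enorm (z - v) by [].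
have zu : z - u != 0.
  apply/eqP => h; move: fz; rewrite fzE h enorm0 add0r.
  by rewrite -[z - v](subrKA u) h add0r ltxx.
have zv : z - v != 0.
  apply/eqP => h; move: fz; rewrite fzE h enorm0 addr0.
  by rewrite -[z - u](subrKA v) h add0r enormB ltxx.
have P0 := enorm_gt0 zu; have Q0 := enorm_gt0 zv.
set p := z - u in zu P0 fzE; set q := z - v in zv Q0 fzE.
(* The gradient at [z] of the sum of the distances to the foci. *)
pose w := (enorm p)^-1 *: p + (enorm q)^-1 *: q.
have pq : - (enorm p * enorm q) < dot p q.
  have : enorm (u - v) ^+ 2 < f z ^+ 2 by rewrite ltr_pXn2r ?nnegrE ?addr_ge0 ?enorm_ge0.
  rewrite fzE sqrrD !sqr_enorm.
  have -> : dot (u - v) (u - v) = dot p p - 2 * dot p q + dot q q.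
    by rewrite /p /q !dot2E !mxE; ring.
  lra.
have pw : dot p w = (enorm p * enorm q + dot p q) / enorm q.
  rewrite /w dotDr !dotZr -sqr_enorm; field.
  by rewrite !gt_eqF.
have qw : dot q w = (enorm p * enorm q + dot p q) / enorm p.
  rewrite /w dotDr !dotZr -sqr_enorm (dotC q p); field.
  by rewrite !gt_eqF.
have S0 : 0 < enorm p * enorm q + dot p q by lra.
have pw0 : 0 < dot p w by rewrite pw divr_gt0.
have qw0 : 0 < dot q w by rewrite qw divr_gt0.
have w0 : w != 0 by apply: contraTneq pw0 => ->; rewrite dot0r ltxx.
exists w, z; split=> //.
- rewrite Cf//; split=> // x Kx; have := zm _ Kx.
  rewrite fzE /f /Defs.edist.
  have hu : dot (x - u) p <= enorm (x - u) * enorm p by exact: dot_le_enorm.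
  have hv : dot (x - v) q <= enorm (x - v) * enorm q by exact: dot_le_enorm.
  rewrite -ler_pdivrMr// in hu; rewrite -ler_pdivrMr// in hv.
  have e1 : dot p p / enorm p = enorm p.
    by rewrite -sqr_enorm expr2 mulfK// gt_eqF.
  have e2 : dot q q / enorm q = enorm q.
    by rewrite -sqr_enorm expr2 mulfK// gt_eqF.
  have -> : dot x w = dot z w + (dot (x - u) p / enorm p - dot p p / enorm p)
      + (dot (x - v) q / enorm q - dot q q / enorm q).
    rewrite /w (dotDr _ _ x) (dotDr _ _ z) !dotZr.
    have -> : dot (x - u) p = dot x p - dot z p + dot p p.
      have -> : x - u = x - z + p by rewrite /p subrKA.
      by rewrite (dotDl (x - z)) dotBl.
    have -> : dot (x - v) q = dot x q - dot z q + dot q q.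
      have -> : x - v = x - z + q by rewrite /q subrKA.
      by rewrite (dotDl (x - z)) dotBl.
    ring.
  lra.
- have uE : u - z = - p by rewrite /p opprB.
  have vE : v - z = - q by rewrite /q opprB.
  rewrite uE vE !dotNl pw qw /w rotD !rotZ !dotDr !dotZr !dot_rotr.
  have -> : dot q (rot p) = - dot p (rot q) by rewrite !dot2E !mxE /=; ring.
  by field; rewrite !gt_eqF.
Qed.

(** The contact point with the ellipse, read in one of the four charts. *)
Lemma typical_reflection C u v : typical C -> exists (k : nat) s,
  [/\ 0 < depth C (axis k) u s, 0 < depth C (axis k) v s &
      mirror C (axis k) u v s = 0].
Proof.
move=> tC; have [w [z [w0 zf zu zv uv]]] := ellipse_contact C u v.
have [k [s [c [c0 wE]]]] := axis_cover w0; exists k, s.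
move: zf; rewrite wE => /(faceZ _ _ _ c0)/(touch_unique tC (axis_unit k)) zE.
move: zu zv uv; rewrite wE rotZ !dotZr zE.
rewrite !pmulr_rgt0// => us vs uvs; split=> //.
have c2 : c * c != 0 by rewrite mulf_neq0// gt_eqF.
apply: (mulfI c2); rewrite mulr0 -[RHS]uvs /mirror /shift /depth; ring.
Qed.

End Images.

(** * Observers that see a perfect set of images *)

Section Observers.
Context {R : realType}.
Implicit Types (p q w x y z E u v : plane R).
Implicit Types (C : convex_curve R) (a b e r s t c : R).

(** A sign change forces a zero between [a] and [b], and the condition on the
    depths makes every such zero an image; both are stable in [u]. *)
Definition flips C E v a b : set (plane R) := [set u |
  (forall s, a <= s -> s <= b -> 0 < depth C E u s /\ 0 < depth C E v s) /\
  mirror C E u v a * mirror C E u v b < 0].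

Lemma depth_shiftE C E u u' s :
  depth C E u' s = depth C E u s - dot (u' - u) (normal E s).
Proof. by rewrite /depth !dotBl; ring. Qed.

Lemma mirror_observer_continuous C E v s :
  continuous (fun u => mirror C E u v s).
Proof.
pose X := depth C E v s *: rot (normal E s) - shift C E v s *: normal E s.
apply: (@enorm_lipschitz_continuous _ _ (enorm X)) => p q.
have -> : mirror C E p v s - mirror C E q v s = dot (p - q) X.
  rewrite /X /mirror (depth_shiftE _ _ q p) (dotBr _ _ (p - q)) !dotZr.
  have -> : shift C E p s = shift C E q s + dot (p - q) (rot (normal E s)).
    by rewrite /shift !dotBl; ring.
  ring.
by rewrite mulrC normr_dot_le.
Qed.

Lemma near_observer_sign C E u v s : mirror C E u v s != 0 ->
  exists2 e, 0 < e & forall u', enorm (u' - u) < e ->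
    0 < mirror C E u v s * mirror C E u' v s.
Proof.
move=> s0; pose f := fun u' => mirror C E u v s * mirror C E u' v s.
have cf : {for u, continuous f}.
  apply: (@cvgM _ _ (nbhs u)); first exact: cvg_cst.
  exact: mirror_observer_continuous.
apply/(nbhs_enormP u [set u' | 0 < f u']).
apply: (cvgr_gt _ cf); rewrite /f -expr2 lt_neqAle sqr_ge0 andbT eq_sym.
exact: expf_neq0.
Qed.

Lemma flips_open C E v a b u : typical C -> dot E E = 1 -> a <= b ->
  flips C E v a b u -> exists2 e, 0 < e & forall u', enorm (u' - u) < e ->
  [/\ flips C E v a b u', 0 < mirror C E u v a * mirror C E u' v a &
      0 < mirror C E u v b * mirror C E u' v b].
Proof.
move=> tC E1 ab [pos ch].
have [ma mb] : mirror C E u v a != 0 /\ mirror C E u v b != 0.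
  by apply/andP; rewrite -negb_or -mulf_eq0 lt_eqF.
have [e1 e10 h1] := near_observer_sign ma.
have [e2 e20 h2] := near_observer_sign mb.
have [s] := EVT_min ab (continuous_subspaceT (depth_continuous (u := u) tC E1)).
rewrite in_itv /= => /andP[as_ sb] smin.
have [us _] := pos _ as_ sb.
pose N := 1 + (`|a| + `|b|).
have N0 : 0 < N by rewrite ltr_pwDl// addr_ge0.
exists (Num.min (depth C E u s / N) (Num.min e1 e2)).
  by rewrite lt_min divr_gt0//= lt_min e10.
move=> u'; rewrite !lt_min => /and3P[u'u /h1 ma' /h2 mb'].
split=> //; split=> [x ax xb|]; last first.
  have : 0 < (mirror C E u v a * mirror C E u' v a) *
      (mirror C E u v b * mirror C E u' v b) by rewrite mulr_gt0.
  by rewrite mulrACA nmulr_rgt0.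
have [_ vx] := pos _ ax xb; split=> //.
have nE : enorm E = 1 by rewrite /enorm E1 sqrtr1.
have nx : enorm (normal E x) <= N.
  rewrite (le_trans (enormD _ _))// enormZ enorm_rot nE mulr1 lerD2l.
  have := ler_norm (- a); rewrite normrN; have := ler_norm b.
  have := normr_ge0 a; have := normr_ge0 b.
  by rewrite ler_norml => *; apply/andP; split; lra.
have xab : x \in `[a, b]%R by rewrite in_itv /= ax xb.
have := smin _ xab.
have := le_trans (dot_le_enorm (u' - u) (normal E x)) (ler_wpM2l (enorm_ge0 _) nx).
by rewrite ltr_pdivlMr// in u'u; rewrite (depth_shiftE _ _ u u'); lra.
Qed.

(** Keeps the intervals of [flips] in a countable family. *)
Lemma rat_signs (f : R -> R) s t : continuous f -> s < t ->
  f s != 0 -> f t != 0 -> exists s' t' : rat,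
  [/\ s < ratr s', ratr s' < ratr t' :> R, ratr t' < t,
      0 < f s * f (ratr s') & 0 < f t * f (ratr t')].
Proof.
move=> cf st s0 t0.
have sq r : f r != 0 -> 0 < f r * f r.
  by move=> r0; rewrite -expr2 lt_neqAle sqr_ge0 andbT eq_sym expf_neq0.
have cM r : continuous (fun x : R => f r * f x).
  by move=> x; apply: cvgM; [exact: cvg_cst|exact: cf].
have [d d0 hd] := near_gt (cM s) (sq s s0).
have [g g0 hg] := near_gt (cM t) (sq t t0).
have [|s'] := @rat_in_itvoo _ s (Num.min (s + d) ((s + t) / 2)).
  by rewrite lt_min; apply/andP; split; lra.
rewrite in_itv /= lt_min => /and3P[ss' s'd s'm].
have [|t'] := @rat_in_itvoo _ (Num.max (t - g) ((s + t) / 2)) t.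
  by rewrite gt_max; apply/andP; split; lra.
rewrite in_itv /= gt_max => /andP[/andP[t'g t'm] t't].
exists s', t'; split=> //.
- exact: lt_trans t'm.
- by apply: hd; rewrite ltr_norml; apply/andP; split; lra.
- by apply: hg; rewrite ltr_norml; apply/andP; split; lra.
Qed.

Lemma flips_zero C E v a b u : typical C -> dot E E = 1 -> a <= b ->
  flips C E v a b u -> exists c, [/\ a < c, c < b & mirror C E u v c = 0].
Proof.
move=> tC E1 ab [_ ch].
have [||c] := @IVT R (mirror C E u v) a b 0 ab.
- by apply: continuous_subspaceT; exact: mirror_continuous.
- have [h|h|h] := ltrgtP (mirror C E u v a) 0.
  + rewrite nmulr_rlt0// in ch.
    by rewrite ge_min le_max (ltW h) (ltW ch) orbT.
  + rewrite pmulr_rlt0// in ch.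
    by rewrite ge_min le_max (ltW h) (ltW ch) orbT.
  + by move: ch; rewrite h mul0r ltxx.
rewrite in_itv /= => /andP[ac cb] mc; exists c; split=> //.
- rewrite lt_neqAle ac andbT; apply: contraTneq ch => ->.
  by rewrite mc mul0r ltxx.
- rewrite lt_neqAle cb andbT; apply: contraTneq ch => <-.
  by rewrite mc mulr0 ltxx.
Qed.

(** A sign change of the mirror functional can be split, by a slight motion of
    the observer, into two sign changes on disjoint arcs: the sign pattern
    opposite to the given one is created in the middle. *)
Lemma flips_split C (k : nat) v a b u e : typical C -> a < b ->
  flips C (axis k) v a b u -> 0 < e -> exists u' (s t : rat),
  [/\ enorm (u' - u) < e, [/\ a < ratr s, s < t & ratr t < b],
      flips C (axis k) v a (ratr s) u' & flips C (axis k) v (ratr t) b u'].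
Proof.
move=> tC ab fl e0; have E1 := axis_unit (R := R) k.
have [c [ac cb mc]] := flips_zero tC E1 (ltW ab) fl.
have [g g0 opn] := flips_open tC E1 (ltW ab) fl.
have [pos ch] := fl; have [uc vc] := pos _ (ltW ac) (ltW cb).
pose d := Num.min (Num.min e g) (Num.min (c - a) (b - c)).
have d0 : 0 < d by do 3 rewrite lt_min; rewrite e0 g0 !subr_gt0 ac.
have de : d <= e by do 2 rewrite ge_min; rewrite lexx.
have dg : d <= g by do 2 rewrite ge_min; rewrite lexx orbT.
have dca : d <= c - a by do 3 rewrite ge_min; rewrite lexx /= orbT.
have dbc : d <= b - c by do 3 rewrite ge_min; rewrite lexx !orbT.
have [u' [s [t [u'u cs st tc [sa tb]]]]] : exists u' s t,
    [/\ enorm (u' - u) < d, c - d < s, s < t, t < c + d &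
    mirror C (axis k) u v a * mirror C (axis k) u' v s < 0 /\
    mirror C (axis k) u v b * mirror C (axis k) u' v t < 0].
  have [h|h|h] := ltrgtP (mirror C (axis k) u v a) 0.
  - rewrite nmulr_rlt0// in ch.
    have [u' [s [t [u'u cs st tc /andP[mt ms]]]]] := typical_falling tC uc vc mc d0.
    by exists u', s, t; split=> //; rewrite nmulr_rlt0// pmulr_rlt0.
  - rewrite pmulr_rlt0// in ch.
    have [u' [s [t [u'u cs st tc /andP[ms mt]]]]] := typical_rising tC uc vc mc d0.
    by exists u', s, t; split=> //; rewrite pmulr_rlt0// nmulr_rlt0.
  - by move: ch; rewrite h mul0r ltxx.
have [[pos' ch'] aa bb] := opn _ (lt_le_trans u'u dg).
have ms0 : mirror C (axis k) u' v s != 0.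
  by apply: contraTneq sa => ->; rewrite mulr0 ltxx.
have mt0 : mirror C (axis k) u' v t != 0.
  by apply: contraTneq tb => ->; rewrite mulr0 ltxx.
have cM := mirror_continuous (u := u') (v := v) tC E1.
have [s' [t' [ss' s't' t't hs ht]]] := rat_signs cM st ms0 mt0.
exists u', s', t'; split.
- exact: lt_le_trans de.
- by split; [lra|rewrite -(ltr_rat R)|lra].
- split=> [x ax xs|]; first by apply: pos'; lra.
  have : 0 < (mirror C (axis k) u v a * mirror C (axis k) u' v a) *
    (mirror C (axis k) u' v s * mirror C (axis k) u' v (ratr s')) by rewrite mulr_gt0.
  by rewrite mulrACA nmulr_rgt0.
- split=> [x tx xb|]; first by apply: pos'; lra.
  have : 0 < (mirror C (axis k) u v b * mirror C (axis k) u' v b) *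
    (mirror C (axis k) u' v t * mirror C (axis k) u' v (ratr t')) by rewrite mulr_gt0.
  by rewrite mulrACA nmulr_rgt0// mulrC.
Qed.

(** Around the contact point of the ellipse a slight motion of the observer
    creates a sign change. *)
Lemma flips_dense C u v e : typical C -> 0 < e ->
  exists u' (k : nat) (s t : rat), [/\ enorm (u' - u) < e, s < t &
    flips C (axis k) v (ratr s) (ratr t) u'].
Proof.
move=> tC e0; have [k [c [uc vc mc]]] := typical_reflection u v tC.
have E1 := axis_unit (R := R) k.
have [m [M [d [m0 _ d0 bnd]]]] := mirror_bounds tC E1 uc vc.
have ed0 : 0 < Num.min e d by rewrite lt_min e0.
have [u' [s [t [u'u cs st tc /andP[mt ms]]]]] := typical_falling tC uc vc mc ed0.
have ede : Num.min e d <= e by rewrite ge_min lexx.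
have edd : Num.min e d <= d by rewrite ge_min lexx orbT.
have cM := mirror_continuous (u := u') (v := v) tC E1.
have [s' [t' [ss' s't' t't hs ht]]] :=
  rat_signs cM st (lt0r_neq0 ms) (ltr0_neq0 mt).
exists u', k, s', t'; split; first exact: lt_le_trans ede.
  by rewrite -(ltr_rat R).
split=> [x sx xt|].
  have xc : `|x - c| < d by rewrite ltr_norml; apply/andP; split; lra.
  have [_ /andP[/andP[mu _] /andP[mv _]] _ _ _] :=
    bnd u' x (lt_le_trans u'u edd) xc.
  by split; exact: lt_le_trans m0 _.
by rewrite pmulr_rgt0// in hs; rewrite nmulr_rgt0// in ht; rewrite pmulr_rlt0.
Qed.

(** The sign changes of such an observer form a Cantor scheme. *)
Definition perfect_observer C v : set (plane R) := [set u |
  (exists (k : nat) (s t : rat), s < t /\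
     flips C (axis k) v (ratr s) (ratr t) u) /\
  forall (k : nat) (a b : rat), a < b ->
    flips C (axis k) v (ratr a) (ratr b) u -> exists s t : rat, [/\ a < s, s < t & t < b] /\
      (flips C (axis k) v (ratr a) (ratr s) u /\
       flips C (axis k) v (ratr t) (ratr b) u)].

Lemma perfect_observer_comeagre C v :
  typical C -> comeagre (perfect_observer C v).
Proof.
move=> tC.
pose G (i : option (nat * rat * rat)) : set (plane R) := [set u | match i with
  | None => exists (k : nat) (s t : rat), s < t /\
     flips C (axis k) v (ratr s) (ratr t) u
  | Some (k, a, b) => a < b -> flips C (axis k) v (ratr a) (ratr b) u ->
    exists s t : rat, [/\ a < s, s < t & t < b] /\
      (flips C (axis k) v (ratr a) (ratr s) u /\
       flips C (axis k) v (ratr t) (ratr b) u) end].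
apply: (@comeagre_countable _ _ G).
  have opn k (s t : rat) u : s < t -> flips C (axis k) v (ratr s) (ratr t) u ->
      exists2 e, 0 < e & forall u', enorm (u' - u) < e ->
      flips C (axis k) v (ratr s) (ratr t) u'.
    move=> st fl; have st' : ratr s <= ratr t :> R by rewrite ler_rat ltW.
    have [e e0 h] := flips_open tC (axis_unit k) st' fl.
    by exists e => // u' /h[].
  move=> [[[k a] b]|]; apply: nowhere_dense_perturb => u U.
  - move=> /not_implyP[ab /not_implyP[fl _]] /nbhs_enormP[e e0 eU].
    have abR : ratr a < ratr b :> R by rewrite ltr_rat.
    have [u' [s [t [u'u [as_ st tb] f1 f2]]]] := flips_split tC abR fl e0.
    rewrite !ltr_rat in as_ tb.
    exists u'; first exact: eU.
    have [e1 e10 h1] := opn _ _ _ _ as_ f1.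
    have [e2 e20 h2] := opn _ _ _ _ tb f2.
    apply/nbhs_enormP; exists (Num.min e1 e2); first by rewrite lt_min e10.
    move=> y; rewrite lt_min => /andP[/h1 g1 /h2 g2]; apply => _ _.
    by exists s, t.
  - move=> _ /nbhs_enormP[e e0 eU].
    have [u' [k [s [t [u'u st fl]]]]] := flips_dense u v tC e0.
    exists u'; first exact: eU.
    have [e1 e10 h1] := opn _ _ _ _ st fl.
    apply/nbhs_enormP; exists e1 => // y /h1 gy; apply.
    by exists k, s, t.
move=> u Gu; split; first exact: (Gu None).
by move=> k a b; exact: (Gu (Some (k, a, b))).
Qed.

End Observers.

Section PerfectSet.
Context {R : realType}.
Implicit Types (I J : rat * rat) (u v : plane R) (C : convex_curve R).

(** Choosing at each stage one of the two halves, a binary sequence selects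
    nested intervals; [f] still has opposite signs, or a zero, at the ends of
    their intersection, hence a zero in it. The intervals need not shrink to
    points. *)
Lemma cantor_zeros (f : R -> R) (P : rat * rat -> Prop) I0 :
  continuous f -> P I0 ->
  (forall I, P I -> I.1 < I.2 /\ f (ratr I.1) * f (ratr I.2) < 0) ->
  (forall I, P I -> exists J,
    [/\ I.1 < J.1, J.1 < J.2 & J.2 < I.2] /\ (P (I.1, J.1) /\ P (J.2, I.2))) ->
  exists x : (nat -> bool) -> R, injective x /\
    forall b, [/\ ratr I0.1 <= x b, x b <= ratr I0.2 & f (x b) = 0].
Proof.
move=> cf P0 Psign Psplit.
have /choice[gap gapP] I : exists J, P I ->
    [/\ I.1 < J.1, J.1 < J.2 & J.2 < I.2] /\ (P (I.1, J.1) /\ P (J.2, I.2)).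
  by have [/Psplit[J hJ]|nP] := pselect (P I); [exists J|exists I].
pose child (d : bool) I := if d then (I.1, (gap I).1) else ((gap I).2, I.2).
pose fix node (b : nat -> bool) n :=
  if n is m.+1 then child (b m) (node b m) else I0.
have nodeP b n : P (node b n).
  elim: n => //= n IH; rewrite /child; have [_ [h1 h2]] := gapP _ IH.
  by case: (b n).
have step b n :
    (node b n).1 <= (node b n.+1).1 /\ (node b n.+1).2 <= (node b n).2.
  have [[h1 h2 h3] _] := gapP _ (nodeP b n).
  rewrite /= /child; case: (b n) => /=; rewrite lexx; split=> //.
  - by rewrite ltW// (lt_trans h2).
  - by rewrite ltW// (lt_trans h1).
have zero b : exists x, f x = 0 /\
    forall n, ratr (node b n).1 <= x /\ x <= ratr (node b n).2.
  pose lo : nat -> R := fun n => ratr (node b n).1.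
  pose hi : nat -> R := fun n => ratr (node b n).2.
  have lo_nd : nondecreasing_seq lo.
    by apply/nondecreasing_seqP => n; rewrite ler_rat; have [] := step b n.
  have hi_ni : nonincreasing_seq hi.
    by apply/nonincreasing_seqP => n; rewrite ler_rat; have [] := step b n.
  have lohi n m : lo n <= hi m.
    have [nm|/ltnW mn] := leqP n m.
      apply: le_trans (lo_nd _ _ nm) _.
      by rewrite ler_rat ltW//; have [] := Psign _ (nodeP b m).
    apply: le_trans _ (hi_ni _ _ mn).
    by rewrite ler_rat ltW//; have [] := Psign _ (nodeP b n).
  have cl : lo @ \oo --> limn lo.
    apply: nondecreasing_is_cvgn => //.
    by exists (hi 0%N) => _ [n _ <-].
  have ch : hi @ \oo --> limn hi.
    apply: nonincreasing_is_cvgn => //.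
    by exists (lo 0%N) => _ [n _ <-].
  have lo_le n : lo n <= limn lo by apply: nondecreasing_cvgn_le.
  have hi_ge n : limn hi <= hi n by apply: nonincreasing_cvgn_ge.
  have lh : limn lo <= limn hi.
    apply: limr_ge => //; apply: nearW => m.
    by apply: limr_le => //; apply: nearW => n.
  have ff : f (limn lo) * f (limn hi) <= 0.
    have cfl : (f (lo n) * f (hi n)) @[n --> \oo] --> f (limn lo) * f (limn hi).
      by apply: cvgM; apply: continuous_cvg => //; exact: cf.
    rewrite -(cvg_lim _ cfl)//; apply: limr_le; first by apply: cvgP cfl.
    by apply: nearW => n; rewrite ltW//; have [] := Psign _ (nodeP b n).
  have [||x] := @IVT R f (limn lo) (limn hi) 0 lh.
  - exact: continuous_subspaceT.
  - have [h|h|h] := ltrgtP (f (limn lo)) 0.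
    + by rewrite nmulr_rle0// in ff; rewrite ge_min le_max (ltW h) ff orbT.
    + by rewrite pmulr_rle0// in ff; rewrite ge_min le_max (ltW h) ff orbT.
    + by rewrite ge_min le_max h lexx.
  rewrite in_itv /= => /andP[lx xh] fx; exists x; split=> // n; split.
  - exact: le_trans (lo_le n) lx.
  - exact: le_trans xh (hi_ge n).
have [x xP] := choice zero.
exists x; split=> [b b' bb|b]; last by have [fx /(_ 0%N)[]] := xP b.
have same_bit n : node b n = node b' n -> b n = b' n.
  move=> nn; have [[_ g _] _] := gapP _ (nodeP b n).
  have [_ /(_ n.+1)[h1 h2]] := xP b; have [_ /(_ n.+1)[h3 h4]] := xP b'.
  have gR : ratr (gap (node b n)).1 < ratr (gap (node b n)).2 :> R.
    by rewrite ltr_rat.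
  move: h1 h2 h3 h4; rewrite /= -nn -bb /child.
  by case: (b n) (b' n) => -[] //=; lra.
have same_node n : node b n = node b' n.
  by elim: n => //= n IH; rewrite (same_bit _ IH) IH.
by apply/funext => n; exact: same_bit.
Qed.

(** Rational cuts embed the line, and coordinatewise the plane, into the space
    of binary sequences. *)
Definition cut (r : R) (n : nat) : bool :=
  if unpickle n is Some q then (ratr (q : rat) : R) < r else false.

Lemma cut_inj : injective cut.
Proof.
move=> r s rs; apply/eqP; rewrite eq_le; apply/andP; split; rewrite leNgt.
  apply/negP => /rat_in_itvoo[q]; rewrite in_itv /= => /andP[h1 h2].
  have := congr1 (fun g => g (pickle q)) rs.
  by rewrite /cut pickleK h2 ltNge (ltW h1).
apply/negP => /rat_in_itvoo[q]; rewrite in_itv /= => /andP[h1 h2].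
have := congr1 (fun g => g (pickle q)) rs.
by rewrite /cut pickleK h2 ltNge (ltW h1).
Qed.

Definition plane_cut (p : plane R) (n : nat) : bool :=
  if odd n then cut (p ord0 ord_max) n./2 else cut (p ord0 ord0) n./2.

Lemma plane_cut_inj : injective plane_cut.
Proof.
move=> p q pq; apply: plane_eqP; apply: cut_inj; apply/funext => n.
  have := congr1 (fun g => g n.*2) pq.
  by rewrite /plane_cut odd_double doubleK.
have := congr1 (fun g => g n.*2.+1) pq.
by rewrite /plane_cut /= odd_double /= uphalf_double.
Qed.

Lemma card_continuum (A : set (plane R)) (g : (nat -> bool) -> plane R)
    (x : (nat -> bool) -> R) : injective x -> injective g ->
  (forall b, A (g b)) -> (A #= [set: R])%card.
Proof.
move=> xi gi Ag; rewrite card_eq_le; apply/andP; split.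
  apply/pcard_injP; exists (x \o plane_cut) => p q _ _ /xi.
  exact: plane_cut_inj.
have gc : {in [set: R] &, injective (g \o cut)}.
  by move=> r s _ _ /gi/cut_inj.
rewrite -(card_le_eql (inj_card_eq gc)); apply: subset_card_le.
by move=> _ [r _ <-]; exact: Ag.
Qed.

(** The zeros of the mirror functional form a Cantor set of slopes, and
    distinct slopes of a smooth curve have distinct points of contact. *)
Lemma perfect_observer_continuum C u v : typical C -> perfect_observer C v u ->
  ([set z : plane R | C z /\ sees_image C u v z] #= [set: R])%card.
Proof.
move=> tC [[k [s [t [st fl]]]] split_].
have E1 := axis_unit (R := R) k.
pose P (I : rat * rat) := [/\ s <= I.1, I.1 < I.2, I.2 <= t &
  flips C (axis k) v (ratr I.1) (ratr I.2) u].
have [||||x [xi x0]] := @cantor_zeros (mirror C (axis k) u v) P (s, t).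
- exact: mirror_continuous.
- by split.
- by move=> I [_ ? _ []].
- move=> [a b] [/= sa ab bt /(split_ _ _ _ ab)[s' [t' [[h1 h2 h3] [f1 f2]]]]].
  exists (s', t'); split=> //=; split; split=> //=.
  + by rewrite (le_trans _ bt)// ltW// (lt_trans h2).
  + by rewrite (le_trans sa)// ltW// (lt_trans h1).
pose g b := touch C (axis k) (x b).
apply: (@card_continuum _ g x) => //.
  by move=> b b' /(touch_inj tC E1)/xi.
move=> b; split; first exact: touch_curve.
have [sx xt xz] := x0 b; have [us vs] := fl.1 _ sx xt.
exact: mirror_sees.
Qed.

End PerfectSet.

Theorem theorem1p2 (R : realType) :
  comeagre [set C : convex_curve R |
    (forall z : plane R, C z -> exists! T, supporting_line C z T) /\
    (forall v : plane R, ~ C v ->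
      comeagre [set u : plane R |
        ([set z : plane R | C z /\ sees_image C u v z] #= [set: R])%card])].
Proof.
apply: (comeagre_superset _ (@typical_comeagre R)) => C tC; split=> [z|v _].
  exact: typical_tangent.
apply: (comeagre_superset _ (perfect_observer_comeagre v tC)) => u.
exact: perfect_observer_continuum.
Qed.
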